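(* There is an algorithm for quantum Approximate Counting that uses only nonadaptive Grover iterations, and that has a query complexity of $O(\sqrt{N/\epsilon})$ (and minimal additional computational overhead). That is: given $N$ and $\epsilon$ with $1/N\le\epsilon\le1$, the algorithm performs one fixed Grover schedule, determined by the known parameters and not by $f$ or $K$, using $O(\sqrt{N/\epsilon})$ queries to $f:[N]\to\{0,1\}$, and then, with minimal additional computational overhead, classically post-processes the results to output a number $\widehat K$; for every $f$ such that $K=\#\{x:f(x)=1\}$ satisfies $1\le K\le N/2$, with high probability $$\frac1{1+\epsilon}\le\frac{\widehat K}{K}\le1+\epsilon .$$ Here ''with high probability'' means with probability at least $1-\delta$ for any fixed constant $\delta>0$, the constant in $O(\cdot)$ being allowed to depend on $\delta$ only.
   Context: Approximate Counting: given quantum query access to $f:[N]\to\{0,1\}$ with $K=\#\{x:f(x)=1\}$ unknown, and a parameter $\epsilon$, output $\widehat K$ with $\frac1{1+\epsilon}\le\widehat K/K\le1+\epsilon$ with high probability. Standing assumptions: $1/N\le\epsilon\le1$ and $1\le K\le N/2$. Grover iterations: a Grover iteration consists of one query to $f$ followed by the Grover diffusion operation. Let $\theta^*=\arcsin\sqrt{K/N}$ (the Grover angle). At the cost of $q\in\mathbb N$ queries, performing $q$ Grover iterations and measuring yields one flip of a coin with bias $\sin^2((2q+1)\theta^* )$. One may first replace $N$ by a constant multiple of $N$, extending $f$ by $0$ (this does not change $K$). For real $r\ge1$ let $\lfloor\!\lfloor r\rfloor\!\rfloor$ be the largest odd integer not exceeding $r$ and let $p(r)=\sin^2(\lfloor\!\lfloor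 r\rfloor\!\rfloor\,\theta^* )$. A Grover schedule consists of two sequences $R=(r_1,\dots,r_m)$ of reals $r_i\ge1$ and $T=(t_1,\dots,t_m)$ of positive integers. Performing it means obtaining independent random variables $\hat p_1,\dots,\hat p_m$, with $\hat p_i$ distributed as $\frac1{t_i}\mathrm{Bin}(t_i,p(r_i))$; this uses at most $\frac12\sum_i r_it_i$ queries. An algorithm using only nonadaptive Grover iterations is one that performs one fixed Grover schedule and produces its output by classically post-processing the results $\hat p_1,\dots,\hat p_m$. *)

(* Defs.v *)
From HB Require Import structures.
From mathcomp Require Import all_boot all_order all_algebra.
From mathcomp Require Import all_classical all_reals all_analysis.

Set Implicit Arguments.
Unset Strict Implicit.
Unset Printing Implicit Defensive.

Import Order.TTheory GRing.Theory Num.Theory.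
Import numFieldNormedType.Exports.

Local Open Scope classical_set_scope.
Local Open Scope ring_scope.

Definition marked (N : nat) (f : 'I_N -> bool) : nat := #|[pred x | f x]|.

(* The extension of f by 0 to a domain c times as large. *)
Definition pad (c N : nat) (f : 'I_N -> bool) (x : 'I_(c * N)) : bool :=
  if insub (x : nat) is Some y then f y else false.

Definition grover_angle (R : realType) (N : nat) (f : 'I_N -> bool) : R :=
  asin (Num.sqrt ((marked f)%:R / N%:R)).

(* The largest odd integer not exceeding r (for 1 <= r). *)
Definition odd_floor (R : realType) (r : R) : nat :=
  \max_(k < (Num.truncn r).+1 | odd k) k.

Definition grover_bias (R : realType) (theta r : R) : R :=
  sin ((odd_floor r)%:R * theta) ^+ 2.

Record grover_schedule (R : realType) := GroverSchedule {
  gs_len : nat ;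
  gs_r : 'I_gs_len -> R ;
  gs_t : 'I_gs_len -> nat ;
  gs_r_ge1 : forall i, 1 <= gs_r i ;
  gs_t_gt0 : forall i, (0 < gs_t i)%N
}.

(* Half the sum of the r_i t_i, and not the exact number of Grover iterations,
   the sum of the t_i (odd_floor r_i - 1) / 2: the latter would make arbitrarily
   many coin flips of bias sin^2 theta (r_i = 1) free, and these alone determine
   K. *)
Definition query_cost (R : realType) (S : grover_schedule R) : R :=
  2^-1 * \sum_i gs_r (g := S) i * (gs_t (g := S) i)%:R.

Definition mutually_independent (R : realType) (d : measure_display)
    (T : measurableType d) (P : probability T R) (I : finType)
    (X : I -> {RV P >-> nat}) : Prop :=
  forall (J : {set I}) (A : I -> set nat),
    P (\bigcap_(i in [set` J]) (X i @^-1` A i)) =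
    (\prod_(i in J) P (X i @^-1` A i))%E.

(* X i is the number of heads among the t_i flips of the i-th coin. *)
Definition performs (R : realType) (S : grover_schedule R) (theta : R)
    (d : measure_display) (T : measurableType d) (P : probability T R)
    (X : 'I_(gs_len S) -> {RV P >-> nat}) : Prop :=
  mutually_independent X /\
  forall (i : 'I_(gs_len S)) (A : set nat),
    distribution P (X i) A =
    binomial_prob (gs_t i) (grover_bias theta (gs_r i)) A.

Definition phat (R : realType) (S : grover_schedule R) (d : measure_display)
    (T : measurableType d) (P : probability T R)
    (X : 'I_(gs_len S) -> {RV P >-> nat}) (w : T) (i : 'I_(gs_len S)) : R :=
  (X i w)%:R / (gs_t i)%:R.

(* The classical computer that post-processes the results is a machine with
   finitely many real registers and unit-cost exact operations.  Its program is
   the body of a loop, repeated until a branch of the body returns a value.  *)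
Inductive unop := Oopp | Oinv | Osqrt | Osin | Ocos | Oasin | Oexp | Oln | Ofloor.

Inductive binop := Oadd | Omul.

Inductive expr (R : realType) :=
| Cst of R
| Reg of nat
| Res of expr R
| Un of unop & expr R
| Bin of binop & expr R & expr R.

Inductive prog (R : realType) :=
| Assign of nat & expr R & prog R
| Test of expr R & expr R & prog R & prog R
| Repeat
| Return of expr R.

Definition eval_unop (R : realType) (o : unop) : R -> R :=
  match o with
  | Oopp => fun x => - x
  | Oinv => fun x => x^-1
  | Osqrt => Num.sqrt
  | Osin => sin
  | Ocos => cos
  | Oasin => asin
  | Oexp => @expR R
  | Oln => @ln R
  | Ofloor => fun x => (Num.floor x)%:~R
  end.

Definition eval_binop (R : realType) (o : binop) : R -> R -> R :=
  match o with
  | Oadd => fun x y => x + y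
  | Omul => fun x y => x * y
  end.

(* Res e reads the result whose index is (the integer part of) the value of e;
   indices start from 0, and reading out of range gives 0. *)
Fixpoint eval (R : realType) (m : nat) (x : 'I_m -> R) (s : nat -> R)
    (e : expr R) : R :=
  match e with
  | Cst a => a
  | Reg k => s k
  | Res e1 => if insub (Num.truncn (eval x s e1)) is Some i then x i else 0
  | Un o e1 => eval_unop o (eval x s e1)
  | Bin o e1 e2 => eval_binop o (eval x s e1) (eval x s e2)
  end.

(* One pass through the loop body: a returned value, or the new registers. *)
Fixpoint pass (R : realType) (m : nat) (x : 'I_m -> R) (p : prog R)
    (s : nat -> R) : R + (nat -> R) :=
  match p with
  | Assign k e q => pass x q (fun j => if j == k then eval x s e else s j)
  | Test e1 e2 q1 q2 =>
      if eval x s e1 <= eval x s e2 then pass x q1 s else pass x q2 s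
  | Repeat => inr s
  | Return e => inl (eval x s e)
  end.

Fixpoint run (R : realType) (m : nat) (x : 'I_m -> R) (p : prog R) (n : nat)
    (s : nat -> R) : option R :=
  if n is n'.+1 then
    match pass x p s with
    | inl y => Some y
    | inr s' => run x p n' s'
    end
  else None.

(* The program is given N and eps in its first two registers and is stopped
   after n passes, with output 0 if it has not returned by then.  A pass costs
   at most the size of p operations, which does not depend on N and eps. *)
Definition post_process (R : realType) (p : prog R) (n : nat) (N : nat) (eps : R)
    (m : nat) (x : 'I_m -> R) : R :=
  odflt 0 (run x p n (fun k => if k is 0%N then N%:R
                               else if k is 1%N then eps else 0)).

(* Main.v *)
(* Idea.  Let [theta] be the Grover angle and [u_k = 3 ^ k * theta].  The scale
   [k] at which [u_k] first leaves a neighbourhood of [0] is visible from the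
   coins of frequency [3 ^ k], and determines [theta] to within a small constant
   times [3 ^ -k].  From then on each stage triples the precision by a Newton
   step on [sin ^ 2 (r * theta)] with [r] of order [3 ^ (k + j)].  The derivative
   of [sin ^ 2 (r * theta)] may vanish, but for one of the two frequencies
   [r = 3 ^ (k + j)] and [r = 3 ^ (k + j) + 2 * 3 ^ k] it does not, since their
   phases differ by [4 * u_k], which is bounded away from the multiples of [pi].
   The second frequency depends on [k], so the nonadaptive schedule runs the
   refinement of every scale.  This is affordable because, [K] being an integer,
   the refinement at scale [k] may stop once [3 ^ j] exceeds [1 / eps] or
   [8 N / 9 ^ k] (then rounding gives [K] exactly): its cost is of order
   [min (3 ^ k / eps) (N / 3 ^ k)], whose sum over [k] is [O (sqrt (N / eps))].
   Stage [j] flips its coins [2 ^ (J - j)] times, where [J] is the last stage, so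
   Chebyshev's inequality and a union bound control the failure probability
   while the last stage still dominates the cost. *)

Require Import Defs.
From HB Require Import structures.
From mathcomp Require Import all_boot all_order all_algebra.
From mathcomp Require Import all_classical all_reals all_analysis.
From mathcomp Require Import ring lra zify.

Import Order.TTheory GRing.Theory Num.Theory.
Import numFieldNormedType.Exports.

Local Open Scope classical_set_scope.
Local Open Scope ring_scope.

(** * Trigonometric estimates *)

Lemma sin_MVT {R : realType} (a b : R) : a <= b ->
  exists2 c, a <= c <= b & sin b - sin a = cos c * (b - a).
Proof.
move=> ab.
have [|c cab ->] := @MVT_segment R sin cos a b ab.
- by apply: continuous_subspaceT => x; exact: continuous_sin.
- by exists c => //; move: cab; rewrite in_itv.
Qed.

Lemma norm_sin_le {R : realType} (x : R) : `|sin x| <= `|x|.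
Proof.
wlog x0 : x / 0 <= x => [hw|].
  have [/hw //|/ltW x0] := leP 0 x.
  by rewrite -normrN -sinN -[X in _ <= X]normrN hw // oppr_ge0.
have [c _] := sin_MVT 0 _ x0.
rewrite sin0 !subr0 => ->; rewrite normrM ler_piMl //; exact: cos_max.
Qed.

Lemma sqr_sin_le {R : realType} (x : R) : sin x ^+ 2 <= x ^+ 2.
Proof. by rewrite -real_normK ?num_real // -[leRHS]real_normK ?num_real // lerXn2r ?nnegrE ?norm_sin_le. Qed.

Lemma cos_ge {R : realType} (x : R) : 1 - x ^+ 2 / 2 <= cos x.
Proof.
have -> : cos x = 1 - 2 * sin (x / 2) ^+ 2.
  have {1}-> : x = (x / 2) *+ 2 by rewrite mulr2n; field.
  rewrite cos_mulr2n cos2sin2 mulr2n; ring.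
have := sqr_sin_le (x / 2); rewrite expr_div_n; lra.
Qed.

(** One use of the mean value theorem, with [cos_ge] at the intermediate point, gives the constant
    [1 / 2]; the sharp [1 / 6] would require a further integration. *)
Lemma norm_sin_sub_le {R : realType} (x : R) : `|sin x - x| <= `|x| ^+ 3 / 2.
Proof.
wlog x0 : x / 0 <= x => [hw|].
  have [/hw //|/ltW x0] := leP 0 x.
  have -> : sin x - x = - (sin (- x) - - x) by rewrite sinN; ring.
  by rewrite normrN -[`|x|]normrN hw // oppr_ge0.
have [c /andP[c0 cx]] := sin_MVT 0 _ x0.
rewrite sin0 !subr0 => ->.
have -> : cos c * x - x = - ((1 - cos c) * x) by ring.
rewrite normrN normrM (ger0_norm x0) ger0_norm ?subr_ge0 ?cos_le1 //.
have -> : x ^+ 3 / 2 = (x ^+ 2 / 2) * x by field.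
apply: ler_wpM2r => //; have := cos_ge c.
have : c ^+ 2 <= x ^+ 2 by rewrite lerXn2r ?nnegrE.
lra.
Qed.

Lemma sin_ge {R : realType} (x : R) : 0 <= x -> x - x ^+ 3 / 2 <= sin x.
Proof.
move=> x0; have := norm_sin_sub_le x; rewrite (ger0_norm x0) ler_distl.
by case/andP; lra.
Qed.

Lemma sqr_sinB {R : realType} (x y : R) :
  sin x ^+ 2 - sin y ^+ 2 = sin (x + y) * sin (x - y).
Proof.
rewrite sinD sinB.
have := cos2Dsin2 x; have := cos2Dsin2 y; move: (sin x) (sin y) (cos x) (cos y).
move=> a b c d h1 h2.
have -> : (a * d + c * b) * (a * d - c * b) = a ^+ 2 * d ^+ 2 - c ^+ 2 * b ^+ 2 by ring.
have -> : d ^+ 2 = 1 - b ^+ 2 by lra.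
have -> : c ^+ 2 = 1 - a ^+ 2 by lra.
ring.
Qed.

Lemma norm_sqr_sinB_le {R : realType} (x y : R) :
  `|sin x ^+ 2 - sin y ^+ 2| <= `|x + y| * `|x - y|.
Proof. by rewrite sqr_sinB normrM ler_pM ?norm_sin_le. Qed.

Lemma norm_sqr_sinB_le1 {R : realType} (x y : R) :
  `|sin x ^+ 2 - sin y ^+ 2| <= `|x - y|.
Proof.
rewrite sqr_sinB normrM -[leRHS]mul1r ler_pM ?norm_sin_le //; exact: sin_max.
Qed.

Lemma norm_sinB_le {R : realType} (x y : R) : `|sin x - sin y| <= `|x - y|.
Proof.
wlog yx : x y / y <= x => [hw|].
  by case: (leP y x) => [/hw //|/ltW /hw]; rewrite distrC [leRHS]distrC.
have [c _ ->] := sin_MVT _ _ yx.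
by rewrite normrM ler_piMl //; exact: cos_max.
Qed.

(** By [sqr_sinB] the increment is [sin (2 * y + phi) * sin phi]. Replacing [sin phi] by [phi] costs
    a cubic term, absorbed because [|phi| <= 1], and dropping [phi] in the other factor costs
    [phi ^ 2]. *)
Lemma newton_remainder {R : realType} (y phi : R) : `|phi| <= 1 ->
  `|sin (y + phi) ^+ 2 - sin y ^+ 2 - phi * sin (2 * y)| <= 2 * phi ^+ 2.
Proof.
move=> phi1; rewrite sqr_sinB.
have -> : y + phi + y = 2 * y + phi by ring.
have -> : y + phi - y = phi by ring.
have -> : sin (2 * y + phi) * sin phi - phi * sin (2 * y) =
   sin (2 * y + phi) * (sin phi - phi) + phi * (sin (2 * y + phi) - sin (2 * y)).
  by ring.
apply: (le_trans (ler_normD _ _)); rewrite !normrM.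
have h1 := sin_max (2 * y + phi).
have h2 := norm_sin_sub_le phi.
have h3 : `|sin (2 * y + phi) - sin (2 * y)| <= `|phi|.
  by apply: (le_trans (norm_sinB_le _ _)); rewrite addrAC subrr add0r.
rewrite -(real_normK (num_real phi)).
have h4 : 0 <= `|phi| by [].
have h5 : `|sin (2 * y + phi)| * `|sin phi - phi| <= `|sin phi - phi|.
  by rewrite ler_piMl.
have h6 : `|phi| * `|sin (2 * y + phi) - sin (2 * y)| <= `|phi| ^+ 2.
  by rewrite expr2 ler_wpM2l.
have h8 : 0 <= `|phi| ^+ 2 by rewrite exprn_ge0.
have h7 : `|phi| ^+ 3 <= `|phi| ^+ 2.
  by rewrite exprSr ler_piMr // exprn_ge0.
lra.
Qed.

(** The phase error after the step is exactly the Taylor remainder plus the sampling error, divided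
    by the slope [sin (2 * (r * t))]. *)
Lemma newton_step {R : realType} (r theta t phat eta psi sigma : R) :
  0 < r -> 0 < sigma -> psi <= 1 -> r * `|theta - t| <= psi ->
  `|phat - sin (r * theta) ^+ 2| <= eta -> sigma <= `|sin (2 * (r * t))| ->
  r * `|theta - (t + (phat - sin (r * t) ^+ 2) / (r * sin (2 * (r * t))))|
    <= (2 * psi ^+ 2 + eta) / sigma.
Proof.
move=> r0 s0 psi1 hpsi heta hs.
set S := sin (2 * (r * t)) in hs *.
have S0 : S != 0 by rewrite -normr_gt0 (lt_le_trans s0).
pose phi := r * (theta - t).
have hphi : `|phi| <= psi by rewrite /phi normrM (gtr0_norm r0).
have := newton_remainder (r * t) phi (le_trans hphi psi1).
have -> : r * t + phi = r * theta by rewrite /phi; ring.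
rewrite -/S => hrem.
rewrite -[X in X * `|_|](gtr0_norm r0) -normrM.
have -> : r * (theta - (t + (phat - sin (r * t) ^+ 2) / (r * S))) =
  - ((sin (r * theta) ^+ 2 - sin (r * t) ^+ 2 - phi * S) +
     (phat - sin (r * theta) ^+ 2)) / S.
  by rewrite /phi; field; rewrite S0 gt_eqF.
rewrite normrM normfV normrN.
apply: ler_pM; rewrite ?invr_ge0 //.
- apply: (le_trans (ler_normD _ _)); apply: lerD => //.
  apply: (le_trans hrem); rewrite ler_pM2l //.
  by rewrite -real_normK ?num_real // lerXn2r ?nnegrE // (le_trans _ hphi).
- by rewrite lef_pV2 // posrE ?normr_gt0.
Qed.

(** If both [|sin x|] and [|sin (x + y)|] were below [1 / 4], writing [y] as the difference of the
    two angles would give [|sin y| < 1 / 2]. *)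
Lemma sin_separated {R : realType} (x y : R) :
  sin x ^+ 2 < 1 / 16 -> 1 / 4 <= sin y ^+ 2 -> 1 / 16 <= sin (x + y) ^+ 2.
Proof.
move=> hx hy; rewrite leNgt; apply/negP => hxy.
have e : sin y = sin (x + y) * cos x - cos (x + y) * sin x.
  by rewrite -sinB; congr sin; ring.
have small (z : R) : sin z ^+ 2 < 1 / 16 -> `|sin z| < 1 / 4.
  move=> hz; rewrite ltNge; apply/negP => h.
  have : (1 / 4) ^+ 2 <= `|sin z| ^+ 2 by rewrite lerXn2r ?nnegrE //; lra.
  rewrite real_normK ?num_real // => h'; lra.
have {}hx := small _ hx; have {}hxy := small _ hxy.
have : `|sin y| < 1 / 2.
  rewrite e; apply: (le_lt_trans (ler_normB _ _)); rewrite !normrM.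
  have h1 : `|sin (x + y)| * `|cos x| <= `|sin (x + y)| by rewrite ler_piMr // cos_max.
  have h2 : `|cos (x + y)| * `|sin x| <= `|sin x| by rewrite ler_piMl // cos_max.
  lra.
move=> h; have : `|sin y| ^+ 2 < (1 / 2) ^+ 2 by rewrite ltrXn2r ?nnegrE //; lra.
rewrite real_normK ?num_real //; lra.
Qed.

Lemma sqr_sin4 {R : realType} (x : R) : let s := sin x ^+ 2 in
  sin (4 * x) ^+ 2 = 16 * s * (1 - s) * (1 - 2 * s) ^+ 2.
Proof.
move=> s.
have -> : 4 * x = (x *+ 2) *+ 2 by rewrite !mulr2n; ring.
rewrite sin_mulr2n [sin (x *+ 2)]sin_mulr2n cos_mulr2n cos2sin2 -/s.
have e : (cos x * sin x) ^+ 2 = (1 - s) * s by rewrite exprMn cos2sin2.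
transitivity (16 * (cos x * sin x) ^+ 2 * (1 - 2 * s) ^+ 2); last by rewrite e; ring.
by rewrite !mulr2n; ring.
Qed.

(** The interval is what is known of [sin ^ 2] at the current estimate: the detection threshold
    bounds it from below and a phase of at most [1 / 2] from above, up to the estimation errors. *)
Lemma sqr_sin4_ge {R : realType} (x : R) :
  7 / 400 <= sin x ^+ 2 -> sin x ^+ 2 <= 13 / 50 ->
  1 / 4 <= sin (4 * x) ^+ 2.
Proof.
rewrite sqr_sin4; set s := sin x ^+ 2 => h1 h2.
(* In [z] the quartic becomes a concave quadratic, so it suffices to bound it at the ends of an
   interval containing [z]. *)
pose z := s * (1 - s).
have -> : 16 * s * (1 - s) * (1 - 2 * s) ^+ 2 = 16 * (z - 4 * z ^+ 2).
  by rewrite /z; ring.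
have h3 : 0 <= (s - 7 / 400) * (13 / 50 - s) by apply: mulr_ge0; lra.
have h4 : 17 / 1000 <= z by rewrite /z; nra.
have h5 : z <= 1 / 5 by rewrite /z; nra.
have h6 : 0 <= (z - 17 / 1000) * (1 / 5 - z) by apply: mulr_ge0; lra.
nra.
Qed.

(** This is the starting point of the Newton steps. Both [u] and the arcsine lie where the cosine is
    at least [1 / 2], so their distance is at most twice that of the sines; the latter is the
    difference of the squares divided by a sum of at least [28 / 100]. *)
Lemma asin_sqrt_close {R : realType} (u q : R) : 0 <= u -> u <= 1 / 2 ->
  1 / 50 <= q -> `|q - sin u ^+ 2| <= 1 / 50 / 100 ->
  `|u - asin (Num.sqrt q)| <= 1 / 500.
Proof.
move=> u0 u1 q0 hq.
have su0 : 0 <= sin u.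
  apply: le_trans (sin_ge _ u0).
  have -> : u - u ^+ 3 / 2 = u * (1 - u ^+ 2 / 2) by field.
  by apply: mulr_ge0 => //; nra.
have su1 : sin u ^+ 2 <= 1 / 4.
  apply: (le_trans (sqr_sin_le _)); nra.
have [hq1 hq2] : q - sin u ^+ 2 <= 1 / 50 / 100 /\ sin u ^+ 2 - q <= 1 / 50 / 100.
  by move: hq; rewrite ler_norml => /andP[]; lra.
have q2 : Num.sqrt q ^+ 2 = q by rewrite sqr_sqrtr //; lra.
set w := Num.sqrt q in q2 *.
have w0 : 0 <= w by rewrite sqrtr_ge0.
have w1 : w <= 6 / 10 by rewrite leNgt; apply/negP => h; nra.
have win : -1 <= w <= 1 by apply/andP; split; lra.
have sa : sin (asin w) = w by apply: asinK; rewrite in_itv.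
have ca : 1 / 2 <= cos (asin w).
  rewrite cos_asin //.
  have -> : 1 / 2 = Num.sqrt ((1 / 2) ^+ 2) :> R by rewrite sqrtr_sqr ger0_norm //; lra.
  rewrite ler_sqrt; nra.
have cu : 1 / 2 <= cos u by apply: le_trans (cos_ge u); nra.
have a0 : 0 <= asin w.
  rewrite leNgt; apply/negP => h.
  have : asin w < 0 -> sin (asin w) < 0.
    move=> _; rewrite -sin0 ltr_sin ?in_itv /=.
    - by [].
    - by rewrite asin_geNpi2 ?asin_lepi2.
    - by rewrite oppr_le0 !divr_ge0 ?pi_ge0.
  by rewrite sa => /(_ h); lra.
have api : asin w <= pi by apply: (le_trans (asin_lepi2 win)); have := pi_ge0 R; lra.
have upi : u <= pi by have := pi_ge2 R; lra.
have hc (c : R) : 0 <= c -> (c <= u) || (c <= asin w) -> 1 / 2 <= cos c.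
  move=> c0 /orP[] h.
  - have cpi : c <= pi := le_trans h upi.
    apply: (le_trans cu); rewrite leNgt; apply/negP.
    by rewrite ltr_cos ?in_itv /= ?u0 ?upi ?c0 ?cpi // ltNge h.
  - have cpi : c <= pi := le_trans h api.
    apply: (le_trans ca); rewrite leNgt; apply/negP.
    by rewrite ltr_cos ?in_itv /= ?a0 ?api ?c0 ?cpi // ltNge h.
have hdiff : `|u - asin w| <= 2 * `|sin u - sin (asin w)|.
  have [h|/ltW h] := leP u (asin w).
  - have [c /andP[c1 c2] e] := sin_MVT _ _ h.
    have k : 1 / 2 <= cos c by apply: hc; rewrite ?c2 ?orbT // (le_trans u0 c1).
    have m0 : 0 <= asin w - u by lra.
    rewrite distrC (distrC (sin u)) e (ger0_norm m0) ger0_norm; nra.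
  - have [c /andP[c1 c2] e] := sin_MVT _ _ h.
    have k : 1 / 2 <= cos c by apply: hc; rewrite ?c2 // (le_trans a0 c1).
    have m0 : 0 <= u - asin w by lra.
    rewrite e (ger0_norm m0) ger0_norm; nra.
rewrite sa in hdiff.
have w2 : 14 / 100 <= w by rewrite leNgt; apply/negP => h; nra.
have su2 : 14 / 100 <= sin u by rewrite leNgt; apply/negP => h; nra.
apply: (le_trans hdiff).
have : (28 / 100) * `|sin u - w| <= 1 / 50 / 100.
  apply: (@le_trans _ _ ((sin u + w) * `|sin u - w|)).
    by apply: ler_wpM2r => //; lra.
  rewrite -[X in X * _]ger0_norm; last by lra.
  rewrite -normrM.
  have -> : (sin u + w) * (sin u - w) = sin u ^+ 2 - w ^+ 2 by ring.
  by rewrite q2 distrC.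
lra.
Qed.

(** * Chebyshev's inequality for the binomial law *)

(** Conditioning on one flip, in the form of Pascal's rule. *)
Lemma sum_binomial_pmfS {R : realType} (p : R) (n : nat) (g : nat -> R) :
  \sum_(k < n.+2) binomial_pmf n.+1 p k * g k =
  (1 - p) * \sum_(k < n.+1) binomial_pmf n p k * g k +
  p * \sum_(k < n.+1) binomial_pmf n p k * g k.+1.
Proof.
have pascal (k : nat) : (k <= n)%N -> binomial_pmf n.+1 p k.+1 =
    p * binomial_pmf n p k + (1 - p) * binomial_pmf n p k.+1.
  move=> kn; rewrite /binomial_pmf /unstable.onem binS mulrnDr subSS addrC; congr (_ + _).
    by rewrite exprS -mulrA mulrnAr.
  move: kn; rewrite leq_eqVlt => /orP[/eqP ->|kn].
    by rewrite bin_small // !mulr0n mulr0.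
  by rewrite mulrnAr mulrCA -exprS subnSK.
have -> : \sum_(k < n.+1) binomial_pmf n p k * g k =
          \sum_(k < n.+2) binomial_pmf n p k * g k.
  rewrite [RHS]big_ord_recr /=.
  by rewrite [X in _ + X * _]/binomial_pmf bin_small // mulr0n mul0r addr0.
rewrite big_ord_recl [in RHS]big_ord_recl /= mulrDr -addrA; congr (_ + _).
  by rewrite /binomial_pmf !bin0 !expr0 !mulr1n !mul1r !subn0 exprS mulrA.
rewrite !mulr_sumr -big_split /=; apply: eq_bigr => k _.
rewrite /bump /= add1n pascal; last by rewrite -ltnS.
ring.
Qed.

(** The centre [a] is arbitrary because the induction on [n] moves it to [a - 1] when the extra flip
    is a head. *)
Lemma binomial_second_moment {R : realType} (p a : R) (n : nat) :
  \sum_(k < n.+1) binomial_pmf n p k * (k%:R - a) ^+ 2 =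
  n%:R * p * (1 - p) + (n%:R * p - a) ^+ 2.
Proof.
elim: n a => [|n IH] a.
  by rewrite big_ord1 /binomial_pmf bin0 subnn !expr0 mulr1n /=; ring.
rewrite (sum_binomial_pmfS p n (fun k : nat => (k%:R - a) ^+ 2)) IH.
under [X in _ + _ * X]eq_bigr => k _.
  have -> : (k.+1%:R - a : R) = k%:R - (a - 1) by rewrite -natr1; ring.
  over.
by rewrite IH -natr1; ring.
Qed.

Lemma binomial_chebyshev {R : realType} (p eta : R) (t : nat) :
  0 <= p -> p <= 1 -> (0 < t)%N -> 0 < eta ->
  (binomial_prob t p [set k | (eta < `|k%:R / t%:R - p|)%R] <=
   (p * (1 - p) / (t%:R * eta ^+ 2))%:E)%E.
Proof.
move=> p0 p1 t0 eta0.
have tR : 0 < t%:R :> R by rewrite ltr0n.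
(* The bound is the expectation of the squared deviation in units of [eta], which dominates the
   indicator of the event term by term. *)
have -> : p * (1 - p) / (t%:R * eta ^+ 2) =
    \sum_(k < t.+1) binomial_pmf t p k * ((k%:R - t%:R * p) ^+ 2 / (t%:R * eta) ^+ 2).
  under eq_bigr do rewrite mulrA.
  rewrite -mulr_suml binomial_second_moment.
  by field; rewrite !gt_eqF.
rewrite (@binomial_probE _ t p p0 p1) -sumEFin; apply: lee_sum => k _.
have pmf0 : 0 <= binomial_pmf t p k by apply: binomial_pmf_ge0; rewrite p0 p1.
rewrite diracE -EFinM lee_fin; apply: ler_wpM2l => //.
case hk : (_ \in _) => /=; last by rewrite divr_ge0 ?sqr_ge0 ?exprn_ge0 // mulr_ge0 // ltW.
move: hk => /set_mem /= h.
rewrite ler_pdivlMr ?exprn_gt0 ?mulr_gt0 // ?mul1r.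
rewrite -[leRHS]real_normK ?num_real //.
apply: lerXn2r; rewrite ?nnegrE //; first by rewrite ltW // mulr_gt0.
have -> : k%:R - t%:R * p = t%:R * (k%:R / t%:R - p) by field; rewrite gt_eqF.
by rewrite normrM (gtr0_norm tR); apply: ler_wpM2l; exact: ltW.
Qed.

(** * The deterministic estimates *)

(** For [1 <= x], the exponent of the least power of 3 strictly above [x]; at a power of 3 it gives
    [3 * x] and not [x]. *)
Definition clog3 {R : realType} (x : R) : nat := (Num.truncn (ln x / ln 3)).+1.

Lemma ln3_gt0 {R : realType} : 0 < ln 3 :> R.
Proof. by rewrite ln_gt0 // ltr1n. Qed.

Lemma expR_mul_ln3 {R : realType} (n : nat) : expR (n%:R * ln 3) = 3 ^+ n :> R.
Proof. by rewrite expRM_natl lnK // posrE. Qed.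

Lemma le_clog3 {R : realType} (x : R) : 1 <= x -> x <= 3 ^+ clog3 x.
Proof.
move=> x1; have x0 : 0 < x by apply: lt_le_trans x1.
rewrite -expR_mul_ln3 -[leLHS]lnK ?posrE // ler_expR.
by rewrite -ler_pdivrMr ?ln3_gt0 // ltW // truncnS_gt.
Qed.

Lemma clog3_le {R : realType} (x : R) : 1 <= x -> 3 ^+ clog3 x <= 3 * x.
Proof.
move=> x1; have x0 : 0 < x by apply: lt_le_trans x1.
rewrite /clog3 exprS ler_pM2l // -expR_mul_ln3 -[leRHS]lnK ?posrE // ler_expR.
by rewrite -ler_pdivlMr ?ln3_gt0 // truncn_le divr_ge0 // ln_ge0 // ler1n.
Qed.

(** The last stage of scale [k]. With [M = clog3 (8 * N)] and [E = clog3 eps^-1], the two terms are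
    the stages that suffice for exact counting and for relative accuracy [eps]. *)
Definition depth (M E k : nat) : nat := minn (M - 2 * k) E.
Definition frequency (k j s : nat) : nat := 3 ^ (k + j) + 2 * s * 3 ^ k.
(** Mixed-radix numbering of scale, stage and variant, shared by the schedule and the program. *)
Definition entry (E k j s : nat) : nat := (k * E.+1 + j) * 2 + s.

(** The invariant [A * |theta - t| <= 1 / 500] survives tripling [A]: since [r <= 5 * A] the phase
    error is at most [1 / 100], and [4 * (2 / 100 ^ 2 + 1 / 5000)] is below [1 / 500]. The range of
    [r] covers both variants of the frequency. *)
Lemma newton_refines {R : realType} (A r theta t q : R) : 0 < A ->
  3 * A <= r -> r <= 5 * A -> A * `|theta - t| <= 1 / 500 ->
  `|q - sin (r * theta) ^+ 2| <= 1 / 50 / 100 ->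
  1 / 16 <= sin (2 * (r * t)) ^+ 2 ->
  3 * A * `|theta - (t + (q - sin (r * t) ^+ 2) / (r * sin (2 * (r * t))))|
    <= 1 / 500.
Proof.
move=> A0 r1 r2 ht hq hs.
have r0 : 0 < r by lra.
have hs' : 1 / 4 <= `|sin (2 * (r * t))|.
  rewrite leNgt; apply/negP => h.
  have : `|sin (2 * (r * t))| ^+ 2 < (1 / 4) ^+ 2 by rewrite ltrXn2r ?nnegrE //; lra.
  rewrite real_normK ?num_real //; lra.
have hpsi : r * `|theta - t| <= 1 / 100.
  have : r * `|theta - t| <= 5 * A * `|theta - t| by apply: ler_wpM2r.
  lra.
have s0 : 0 < 1 / 4 :> R by lra.
have p1 : 1 / 100 <= 1 :> R by lra.
have h := newton_step _ _ _ _ _ _ _ r0 s0 p1 hpsi hq hs'.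
apply: (@le_trans _ _ (r * `|theta - (t + (q - sin (r * t) ^+ 2) / (r * sin (2 * (r * t))))|)).
  exact: ler_wpM2r.
apply: (le_trans h); lra.
Qed.

(* The frequencies of a stage differ by [2 * 3 ^ k], so their derivatives cannot both vanish. *)
Lemma frequency_choice {R : realType} (k j : nat) (theta t : R) :
  1 / 50 - 1 / 50 / 100 <= sin (3 ^+ k * theta) ^+ 2 ->
  0 <= 3 ^+ k * theta -> 3 ^+ k * theta <= 1 / 2 ->
  3 ^+ k * `|theta - t| <= 1 / 500 ->
  sin (2 * ((frequency k j 0)%:R * t)) ^+ 2 < 1 / 16 ->
  1 / 16 <= sin (2 * ((frequency k j 1)%:R * t)) ^+ 2.
Proof.
move=> h1 h0 h2 h3 h4.
have e : 2 * ((frequency k j 1)%:R * t) =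
    2 * ((frequency k j 0)%:R * t) + 4 * (3 ^+ k * t).
  rewrite /frequency muln0 mul0n addn0 muln1 natrD natrM !natrX; ring.
rewrite e; apply: sin_separated => //.
have hd := norm_sqr_sinB_le1 (3 ^+ k * theta) (3 ^+ k * t).
have hd' : `|3 ^+ k * theta - 3 ^+ k * t| <= 1 / 500.
  by rewrite -mulrBr normrM ger0_norm ?exprn_ge0.
have [] := ler_normlP _ _ (le_trans hd hd') => h5 h6.
have h7 := sqr_sin_le (3 ^+ k * theta).
have h8 : (3 ^+ k * theta) ^+ 2 <= 1 / 4 by nra.
by apply: sqr_sin4_ge; lra.
Qed.

(** An error below [1 / 2] is removed by rounding. Otherwise the second alternative holds, and
    rounding adds at most [1 / 2], hence at most doubles the error. *)
Lemma floor_round_close {R : realType} (K : nat) (x eps : R) : 0 < eps ->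
  `|x - K%:R| < 1 / 2 \/ `|x - K%:R| <= eps * K%:R / 4 ->
  `|(Num.floor (x + 1 / 2))%:~R - K%:R| <= eps * K%:R / 2.
Proof.
move=> eps0 hx.
have [h|h] := ltP `|x - K%:R| (1 / 2).
  suff -> : Num.floor (x + 1 / 2) = K%:Z.
    by rewrite subrr normr0 divr_ge0 // mulr_ge0 // ltW.
  apply: floor_def; rewrite intrD -!pmulrn.
  move: h; rewrite ltr_norml => /andP[h1 h2]; apply/andP; split; lra.
have {}hx : `|x - K%:R| <= eps * K%:R / 4 by case: hx => //; rewrite ltNge h.
have h1 := floor_le (x + 1 / 2).
have h2 := floorD1_gt (x + 1 / 2).
rewrite intrD in h2.
have : `|(Num.floor (x + 1 / 2))%:~R - K%:R| <= 1 / 2 + `|x - K%:R|.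
  have -> : (Num.floor (x + 1 / 2))%:~R - K%:R =
    ((Num.floor (x + 1 / 2))%:~R - x) + (x - K%:R) by ring.
  apply: (le_trans (ler_normD _ _)); rewrite lerD2r ler_norml.
  apply/andP; split; lra.
lra.
Qed.

Lemma relative_error {R : realType} (K : nat) (y eps : R) :
  (0 < K)%N -> 0 < eps -> eps <= 1 -> `|y - K%:R| <= eps * K%:R / 2 ->
  (1 + eps)^-1 <= y / K%:R <= 1 + eps.
Proof.
move=> K0 eps0 eps1; rewrite ler_norml => /andP[h1 h2].
have KR : 0 < K%:R :> R by rewrite ltr0n.
have m0 : 0 < eps * K%:R by rewrite mulr_gt0.
apply/andP; split.
- rewrite ler_pdivlMr // ler_pdivrMl; last by lra.
  have : (1 + eps) * (K%:R - eps * K%:R / 2) <= (1 + eps) * y by apply: ler_wpM2l; lra.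
  have : eps * (eps * K%:R) <= 1 * (eps * K%:R) by apply: ler_wpM2r => //; exact: ltW.
  lra.
- by rewrite ler_pdivrMr //; lra.
Qed.

(* [K] is known to within [1/2] if [D <= A ^+ 2 * L], as then
   [D * sin theta * |theta - t|] is small, and to within [eps * K / 4] if
   [eps^-1 <= L]; rounding is harmless in both cases. *)
Lemma count_from_angle {R : realType} (K : nat) (D A L theta t eps : R) :
  (0 < K)%N -> 0 < eps -> eps <= 1 -> 0 < D -> 1 <= A -> 1 <= L ->
  D * sin theta ^+ 2 = K%:R -> 7 / 50 <= A * theta -> A * theta <= 1 / 2 ->
  A * L * `|theta - t| <= 1 / 500 ->
  D <= A ^+ 2 * L \/ eps^-1 <= L ->
  (1 + eps)^-1 <= (Num.floor (D * sin t ^+ 2 + 1 / 2))%:~R / K%:R <= 1 + eps.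
Proof.
move=> K0 eps0 eps1 D0 A1 L1 hK hu1 hu2 ht hL.
apply: relative_error => //; apply: floor_round_close => //.
have A0 : 0 < A by lra.
have L0 : 0 < L by lra.
pose d := `|theta - t|.
have d0 : 0 <= d by rewrite normr_ge0.
have hd1 : A * d <= 1 / 500.
  apply: le_trans ht; rewrite -/d -mulrA mulrCA; apply: ler_peMl => //.
  by rewrite mulr_ge0 // ltW.
have hsum : A * `|t + theta| <= 501 / 500.
  have -> : t + theta = 2 * theta - (theta - t) by ring.
  have : `|2 * theta - (theta - t)| <= 2 * theta + d.
    apply: (le_trans (ler_normB _ _)); rewrite -/d lerD2r ger0_norm //.
    have : 0 <= A * theta by lra.
    by rewrite pmulr_rge0 // => ?; lra.
  move=> h; have := ler_wpM2l (ltW A0) h; rewrite mulrDr; lra.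
pose Z := D / A ^+ 2.
have Z0 : 0 < Z by rewrite divr_gt0 // exprn_gt0.
have herr : `|D * sin t ^+ 2 - K%:R| <= Z * (501 / 500) / 500 / L.
  rewrite -hK -mulrBr normrM (gtr0_norm D0).
  have h := norm_sqr_sinB_le t theta.
  apply: (@le_trans _ _ (Z / L * ((A * `|t + theta|) * (A * L * d)))).
    rewrite /d [`|theta - t|]distrC.
    have -> : Z / L * (A * `|t + theta| * (A * L * `|t - theta|)) =
      D * (`|t + theta| * `|t - theta|).
      by rewrite /Z; field; rewrite !gt_eqF.
    by apply: ler_wpM2l => //; exact: ltW.
  have -> : Z * (501 / 500) / 500 / L = Z / L * (501 / 500 * (1 / 500)).
    by field; rewrite gt_eqF.
  apply: ler_wpM2l; first by rewrite divr_ge0 // ltW.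
  by apply: ler_pM => //; rewrite ?mulr_ge0 ?normr_ge0 // ltW.
case: hL => [hL|hL]; [left|right].
  apply: (le_lt_trans herr).
  have : Z / L <= 1.
    by rewrite ler_pdivrMr // mul1r /Z ler_pdivrMr ?exprn_gt0 // mulrC.
  have -> : Z * (501 / 500) / 500 / L = Z / L * (501 / 500) / 500 by ring.
  lra.
apply: (le_trans herr).
(* The lower bound on [A * theta] makes [Z] at most a constant times [K], which turns the absolute
   error into a relative one. *)
have hZ : Z * (15 / 1000) <= K%:R.
  have -> : K%:R = Z * (A * sin theta) ^+ 2.
    by rewrite -hK /Z; field; rewrite gt_eqF.
  apply: ler_wpM2l; first exact: ltW.
  have th0 : 0 <= theta.
    have : 0 <= A * theta by lra.
    by rewrite pmulr_rge0.
  have th1 : theta <= 1 / 2.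
    by apply: le_trans hu2; rewrite ler_peMl.
  have hs : 7 / 8 * theta <= sin theta.
    apply: le_trans (sin_ge theta th0).
    have -> : theta - theta ^+ 3 / 2 = (1 - theta ^+ 2 / 2) * theta by field.
    by apply: ler_wpM2r => //; nra.
  have hs' : 49 / 400 <= A * sin theta.
    by have := ler_wpM2l (ltW A0) hs; lra.
  have : (49 / 400) ^+ 2 <= (A * sin theta) ^+ 2.
    by apply: lerXn2r; rewrite ?nnegrE; lra.
  lra.
have hLe : L^-1 <= eps by rewrite -[leRHS]invrK lef_pV2 ?posrE ?invr_gt0.
have h1 : Z / L <= Z * eps by apply: ler_wpM2l => //; exact: ltW.
have h2 : eps * (Z * (15 / 1000)) <= eps * K%:R
  by exact: ler_wpM2l (ltW eps0) _ _ hZ.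
have -> : Z * (501 / 500) / 500 / L = Z / L * (501 / 500) / 500 by ring.
have h3 : 0 < Z * eps by rewrite mulr_gt0.
lra.
Qed.

(** * The post-processing program *)

Definition Sub {R : realType} (a b : expr R) : expr R := Bin Oadd a (Un Oopp b).
Definition Clog3 {R : realType} (a : expr R) : expr R :=
  Bin Oadd (Un Ofloor (Bin Omul (Un Oln a) (Cst (ln 3)^-1))) (Cst 1).
Definition Pow3 {R : realType} (a : expr R) : expr R :=
  Un Oexp (Bin Omul a (Cst (ln 3))).
Definition Sqr {R : realType} (a : expr R) : expr R := Bin Omul a a.

(* Registers: 0 = N, 1 = eps, 2 = phase, 3 = scale k, 4 = stage j, 5 = angle. *)
Definition Domain {R : realType} : expr R := Bin Omul (Cst 8) (Reg R 0).
Definition Accuracy {R : realType} : expr R := Clog3 (Un Oinv (Reg R 1)).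
Definition Entry {R : realType} (s : nat) : expr R :=
  Bin Oadd (Bin Omul (Bin Oadd (Bin Omul (Reg R 3) (Bin Oadd Accuracy (Cst 1))) (Reg R 4))
    (Cst 2)) (Cst s%:R).
Definition Frequency {R : realType} (s : nat) : expr R :=
  Bin Oadd (Pow3 (Bin Oadd (Reg R 3) (Reg R 4)))
    (Bin Omul (Cst (2 * s)%:R) (Pow3 (Reg R 3))).
Definition Phase {R : realType} (s : nat) : expr R :=
  Bin Omul (Frequency s) (Reg R 5).
Definition Slope {R : realType} (s : nat) : expr R :=
  Un Osin (Bin Omul (Cst 2) (Phase s)).

Definition newton_prog {R : realType} (s : nat) : prog R :=
  Assign 5 (Bin Oadd (Reg R 5)
      (Bin Omul (Sub (Res (Entry s)) (Sqr (Un Osin (Phase s))))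
        (Un Oinv (Bin Omul (Frequency s) (Slope s)))))
    (Assign 4 (Bin Oadd (Reg R 4) (Cst 1)) (Repeat R)).

Definition return_prog {R : realType} : prog R :=
  Return (Un Ofloor (Bin Oadd (Bin Omul Domain (Sqr (Un Osin (Reg R 5)))) (Cst (1 / 2)))).

(** Phase 0 scans the scales until a coin exceeds [1 / 50] and inverts the sine there; phase 1 makes
    one Newton step per pass, choosing the variant by its slope. The two tests on the stage compare
    it with [depth]. *)
Definition counting_prog {R : realType} : prog R :=
  Test (Reg R 2) (Cst 0)
    (Test (Res (Entry 0)) (Cst (1 / 50))
      (Assign 3 (Bin Oadd (Reg R 3) (Cst 1)) (Repeat R))
      (Assign 5 (Bin Omul (Un Oasin (Un Osqrt (Res (Entry 0)))) (Un Oinv (Pow3 (Reg R 3))))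
        (Assign 4 (Cst 1) (Assign 2 (Cst 1) (Repeat R)))))
    (Test (Reg R 4) (Sub (Clog3 Domain) (Bin Omul (Cst 2) (Reg R 3)))
      (Test (Reg R 4) Accuracy
        (Test (Cst (1 / 16)) (Sqr (Slope 0)) (newton_prog 0) (newton_prog 1))
        return_prog)
      return_prog).

(** Same default as [Res] out of range, so that entries can be addressed by their number without a
    bound proof. *)
Definition result {R : realType} (m : nat) (x : 'I_m -> R) (n : nat) : R :=
  if insub n is Some i then x i else 0.

Definition state {R : realType} (N : nat) (eps : R) (phase k j : nat) (t : R)
    (s : nat -> R) : Prop :=
  [/\ s 0 = N%:R, s 1%N = eps & s 2%N = phase%:R] /\
  [/\ s 3%N = k%:R, s 4%N = j%:R & s 5%N = t].

(** * Values of the program's expressions and effect of one pass *)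

Lemma floor_truncn {R : realType} (x : R) : 0 <= x ->
  (Num.floor x)%:~R = (Num.truncn x)%:R :> R.
Proof.
move=> x0; rewrite truncn_floor x0.
have : (0 <= Num.floor x) by rewrite floor_ge0.
by case: (Num.floor x).
Qed.

Lemma eval_Clog3 {R : realType} (m : nat) (x : 'I_m -> R) s a (v : R) :
  Defs.eval x s a = v -> 1 <= v -> Defs.eval x s (Clog3 a) = (clog3 v)%:R.
Proof.
move=> e v1; rewrite /= e floor_truncn ?divr_ge0 ?ln_ge0 ?ler1n //.
by rewrite natr1.
Qed.

Lemma eval_Pow3 {R : realType} (m : nat) (x : 'I_m -> R) s a (n : nat) :
  Defs.eval x s a = n%:R -> Defs.eval x s (Pow3 a) = (3 ^ n)%:R.
Proof. by move=> /= ->; rewrite expR_mul_ln3 natrX. Qed.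

Lemma eval_Accuracy {R : realType} (m : nat) (x : 'I_m -> R) (N : nat) (eps : R) ph k j t s :
  0 < eps -> eps <= 1 -> state N eps ph k j t s ->
  Defs.eval x s Accuracy = (clog3 eps^-1)%:R.
Proof.
move=> e0 e1 [[_ s1 _] _]; apply: eval_Clog3; first by rewrite /= s1.
by rewrite invf_ge1.
Qed.

Lemma eval_Entry {R : realType} (m : nat) (x : 'I_m -> R) (N : nat) (eps : R) ph k j t s (b : nat) :
  0 < eps -> eps <= 1 -> state N eps ph k j t s ->
  Defs.eval x s (Res (Entry b)) = result m x (entry (clog3 eps^-1) k j b).
Proof.
move=> e0 e1 st; rewrite /result /entry.
have -> : Defs.eval x s (Res (Entry b)) =
  if insub (Num.truncn (Defs.eval x s (Entry b))) is Some i then x i else 0 by [].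
have -> : Defs.eval x s (Entry b) = ((k * (clog3 eps^-1).+1 + j) * 2 + b)%:R.
  have -> : Defs.eval x s (Entry b) = (s 3%N * (Defs.eval x s Accuracy + 1) + s 4%N) * 2 + b%:R by [].
  rewrite (eval_Accuracy _ x _ _ _ _ _ _ _ e0 e1 st); case: st => _ [-> -> _].
  have e : (clog3 eps^-1)%:R + 1 = (clog3 eps^-1).+1%:R :> R by rewrite natr1.
  by rewrite e -natrM -natrD -natrM -natrD.
by rewrite natrK.
Qed.

Lemma eval_Frequency {R : realType} (m : nat) (x : 'I_m -> R) (N : nat) (eps : R) ph k j t s (b : nat) :
  state N eps ph k j t s ->
  Defs.eval x s (Frequency b) = (frequency k j b)%:R.
Proof.
move=> [_ [s3 s4 _]].
have -> : Defs.eval x s (Frequency b) = Defs.eval x s (Pow3 (Bin Oadd (Reg R 3) (Reg R 4))) +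
    (2 * b)%:R * Defs.eval x s (Pow3 (Reg R 3)) by [].
rewrite (eval_Pow3 _ _ _ _ (k + j)%N); last by rewrite /= s3 s4 natrD.
rewrite (eval_Pow3 _ _ _ _ k) //.
by rewrite /frequency natrD (natrM _ (2 * b)).
Qed.

Lemma eval_Slope {R : realType} (m : nat) (x : 'I_m -> R) (N : nat) (eps : R) ph k j t s (b : nat) :
  state N eps ph k j t s ->
  Defs.eval x s (Slope b) = sin (2 * ((frequency k j b)%:R * t)).
Proof.
move=> st.
have -> : Defs.eval x s (Slope b) = sin (2 * (Defs.eval x s (Frequency b) * s 5%N)) by [].
by rewrite (eval_Frequency _ x _ _ _ _ _ _ _ _ st); case: st => _ [_ _ ->].
Qed.

Lemma pass_newton {R : realType} (m : nat) (x : 'I_m -> R) (N : nat) (eps : R) k j t s (b : nat) :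
  0 < eps -> eps <= 1 -> state N eps 1 k j t s ->
  let r := (frequency k j b)%:R in
  exists2 s', pass x (newton_prog b) s = inr s' &
    state N eps 1 k j.+1
      (t + (result m x (entry (clog3 eps^-1) k j b) - sin (r * t) ^+ 2) /
           (r * sin (2 * (r * t)))) s'.
Proof.
move=> e0 e1 st r.
set v := t + _.
exists (fun i => if i == 4%N then s 4%N + 1 else if i == 5%N then v else s i).
  have hE := eval_Entry _ x _ _ _ _ _ _ _ b e0 e1 st.
  have hF := eval_Frequency _ x _ _ _ _ _ _ _ b st.
  have hS := eval_Slope _ x _ _ _ _ _ _ _ b st.
  have s5 : s 5%N = t by case: st => _ [].
  have hv : v = s 5%N + (Defs.eval x s (Res (Entry b)) -
      sin (Defs.eval x s (Frequency b) * s 5%N) * sin (Defs.eval x s (Frequency b) * s 5%N)) *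
    (Defs.eval x s (Frequency b) * Defs.eval x s (Slope b))^-1.
    by rewrite hE hF hS s5 -expr2.
  by rewrite hv.
case: st => [[s0 s1 s2] [s3 s4 s5]].
by split; split => //=; rewrite s4 natr1.
Qed.

Lemma pass_counting_prog {R : realType} (m : nat) (x : 'I_m -> R) (N : nat) (eps : R) k j t s :
  (0 < N)%N -> 0 < eps -> eps <= 1 -> state N eps 1 k j t s ->
  pass x counting_prog s =
  if (j%:R <= (clog3 (8 * N%:R : R))%:R - 2 * k%:R :> R) && (j <= clog3 eps^-1)%N then
    if 1 / 16 <= sin (2 * ((frequency k j 0)%:R * t)) ^+ 2
    then pass x (newton_prog 0) s else pass x (newton_prog 1) s
  else inl (Num.floor (8 * N%:R * sin t ^+ 2 + 1 / 2))%:~R.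
Proof.
move=> N0 e0 e1 st.
have hW := eval_Accuracy _ x _ _ _ _ _ _ _ e0 e1 st.
have hS := eval_Slope _ x _ _ _ _ _ _ _ 0 st.
have hD : Defs.eval x s (Clog3 Domain) = (clog3 (8 * N%:R : R))%:R.
  apply: eval_Clog3; first by case: st => [[/= -> _ _] _].
  by rewrite -natrM ler1n muln_gt0.
have hR : pass x return_prog s = inl (Num.floor (8 * N%:R * sin t ^+ 2 + 1 / 2))%:~R.
  by case: st => [[s0 _ _] [_ _ s5]]; rewrite /= s0 s5 expr2.
have -> : pass x counting_prog s =
  if s 2%N <= 0 then
    pass x (Test (Res (Entry 0)) (Cst (1 / 50))
      (Assign 3 (Bin Oadd (Reg R 3) (Cst 1)) (Repeat R))
      (Assign 5 (Bin Omul (Un Oasin (Un Osqrt (Res (Entry 0)))) (Un Oinv (Pow3 (Reg R 3))))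
        (Assign 4 (Cst 1) (Assign 2 (Cst 1) (Repeat R))))) s
  else if s 4%N <= Defs.eval x s (Clog3 Domain) - 2 * s 3%N then
    if s 4%N <= Defs.eval x s Accuracy then
      if 1 / 16 <= Defs.eval x s (Slope 0) * Defs.eval x s (Slope 0) then
        pass x (newton_prog 0) s else pass x (newton_prog 1) s
      else pass x return_prog s
    else pass x return_prog s by [].
rewrite hR hW hS hD -expr2.
have [_ _ ->] := st.1; have [-> -> _] := st.2.
rewrite ler_nat ler10 /=.
by case: (_ <= _ - _); case: (_ <= _)%N.
Qed.

(** * Runs of the program *)

Lemma result_ord {R : realType} (m : nat) (x : 'I_m -> R) (i : 'I_m) :
  result m x i = x i.
Proof. by rewrite /result valK. Qed.

Lemma runS {R : realType} (m : nat) (x : 'I_m -> R) p n s :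
  run x p n.+1 s = match pass x p s with inl y => Some y | inr s' => run x p n s' end.
Proof. by []. Qed.

(** Induction on the passes left: stage [i.+1] is entered with an angle error of at most
    [3 ^- (k + i) / 500]. The strict bound on [n] leaves one pass for returning. *)
Lemma run_refine {R : realType} (m : nat) (x : 'I_m -> R) (N : nat) (eps theta : R)
    (k : nat) (M := clog3 (8 * N%:R : R)) (E := clog3 eps^-1) :
  (0 < N)%N -> 0 < eps -> eps <= 1 -> (2 * k <= M)%N ->
  1 / 50 - 1 / 50 / 100 <= sin (3 ^+ k * theta) ^+ 2 ->
  0 <= 3 ^+ k * theta -> 3 ^+ k * theta <= 1 / 2 ->
  (forall j b, (0 < j <= depth M E k)%N -> (b < 2)%N ->
    `|result m x (entry E k j b) - sin ((frequency k j b)%:R * theta) ^+ 2|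
      <= 1 / 50 / 100) ->
  forall n i t s, state N eps 1 k i.+1 t s -> (i <= depth M E k)%N ->
  3 ^+ (k + i) * `|theta - t| <= 1 / 500 -> (depth M E k - i < n)%N ->
  exists2 t', run x counting_prog n s =
      Some (Num.floor (8 * N%:R * sin t' ^+ 2 + 1 / 2))%:~R &
    3 ^+ (k + depth M E k) * `|theta - t'| <= 1 / 500.
Proof.
move=> N0 e0 e1 kM h1 h0 h2 hq; elim=> [//|n IH] i t s st iJ ht hn.
rewrite runS (pass_counting_prog _ x _ _ _ _ _ _ N0 e0 e1 st).
(* As [2 * k <= M], the real difference tested by the program agrees with the truncated one in
   [depth]. *)
have -> : (i.+1%:R <= (clog3 (8 * N%:R : R))%:R - 2 * k%:R :> R) &&
    (i.+1 <= clog3 eps^-1)%N = (i < depth M E k)%N.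
  by rewrite -(natrM _ 2 k) -natrB // ler_nat /depth leq_min.
case: ltnP => [iltJ|Jlei]; last first.
  exists t => //; suff <- : i = depth M E k by [].
  by apply/eqP; rewrite eqn_leq iJ Jlei.
have pow_le : (3 : R) ^+ k <= 3 ^+ (k + i) by rewrite ler_weXn2l ?ler1n // leq_addr.
have ht' : 3 ^+ k * `|theta - t| <= 1 / 500.
  by apply: le_trans ht; apply: ler_wpM2r.
have step b : (b < 2)%N -> 1 / 16 <= sin (2 * ((frequency k i.+1 b)%:R * t)) ^+ 2 ->
  exists2 t', match pass x (newton_prog b) s with
     | inl y => Some y | inr s' => run x counting_prog n s' end =
      Some (Num.floor (8 * N%:R * sin t' ^+ 2 + 1 / 2))%:~R &
    3 ^+ (k + depth M E k) * `|theta - t'| <= 1 / 500.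
  move=> b2 hs; have [s' -> st'] := pass_newton _ x _ _ _ _ _ _ b e0 e1 st.
  apply: (IH _ _ _ st') => //; last by rewrite subnS; lia.
  rewrite addnS exprS; apply: newton_refines => //; last exact: hq.
  - rewrite /frequency natrD natrX addnS exprS lerDl; exact: ler0n.
  - rewrite /frequency natrD !natrM !natrX addnS exprS.
    have b1 : b%:R <= 1 :> R by rewrite lern1 -ltnS.
    have : b%:R * 3 ^+ k <= 1 * 3 ^+ (k + i) :> R by apply: ler_pM; rewrite ?exprn_ge0.
    lra.
case: ifPn => [hs|]; first exact: step.
rewrite -ltNge => hs; apply: step => //.
exact: (frequency_choice k i.+1 theta t).
Qed.

(** Integrality of [K] enters here: [1 <= K] gives [1 <= 8 * N * theta ^ 2], while
    [(3 ^ k * theta) ^ 2 <= 1], so [9 ^ k <= 8 * N]. This bounds the scan and the number of rows of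
    the table. *)
Lemma small_scale_le {R : realType} (K N : nat) (theta : R) (k : nat) :
  (0 < K)%N -> (0 < N)%N -> 8 * N%:R * sin theta ^+ 2 = K%:R -> 0 <= theta ->
  3 ^+ k * theta <= 1 / 2 -> (2 * k <= clog3 (8 * N%:R : R))%N.
Proof.
move=> K0 N0 hK th0 hu.
have D1 : 1 <= 8 * N%:R :> R by rewrite -natrM ler1n muln_gt0.
rewrite -(ler_eXn2l (x := 3 : R)) ?ltr1n //.
apply: le_trans (le_clog3 _ D1).
have p0 : 0 < 3 ^+ k :> R by rewrite exprn_gt0.
have K1 : 1 <= K%:R :> R by rewrite ler1n.
have h1 : 1 <= 8 * N%:R * theta ^+ 2.
  apply: (le_trans K1); rewrite -hK; apply: ler_wpM2l; last exact: sqr_sin_le.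
  by rewrite mulr_ge0.
have h2 : (3 ^+ k) ^+ 2 * theta ^+ 2 <= 1.
  rewrite -exprMn; have : 0 <= 3 ^+ k * theta by rewrite mulr_ge0 // ltW.
  nra.
have h3 : 0 < theta ^+ 2.
  by rewrite -(pmulr_rgt0 (x := 8 * N%:R)) ?(lt_le_trans ltr01) // .
rewrite mulnC exprM -(ler_pM2r h3); exact: le_trans h2 h1.
Qed.

(** The scan keeps [u = 3 ^ k * theta] at most [1 / 2]. A coin at or below the threshold forces
    [u <= 1 / 6], so tripling is safe; a coin above it forces [7 / 50 <= u], and refinement
    starts. *)
Lemma run_counting_prog {R : realType} (m : nat) (x : 'I_m -> R) (N K : nat) (eps theta : R)
    (M := clog3 (8 * N%:R : R)) (E := clog3 eps^-1) :
  (0 < K)%N -> (0 < N)%N -> 0 < eps -> eps <= 1 ->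
  8 * N%:R * sin theta ^+ 2 = K%:R -> 0 <= theta ->
  (forall k, 3 ^+ k * theta <= 1 / 2 ->
    `|result m x (entry E k 0 0) - sin (3 ^+ k * theta) ^+ 2| <= 1 / 50 / 100) ->
  (forall k j b, 7 / 50 <= 3 ^+ k * theta -> 3 ^+ k * theta <= 1 / 2 ->
    (0 < j <= depth M E k)%N -> (b < 2)%N ->
    `|result m x (entry E k j b) - sin ((frequency k j b)%:R * theta) ^+ 2|
      <= 1 / 50 / 100) ->
  forall n k t s, state N eps 0 k 0 t s -> 3 ^+ k * theta <= 1 / 2 ->
  (M + E + 3 - k <= n)%N ->
  exists2 y, run x counting_prog n s = Some y &
    (1 + eps)^-1 <= y / K%:R <= 1 + eps.
Proof.
move=> K0 N0 e0 e1 hK th0 hdet href.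
have D1 : 1 <= 8 * N%:R :> R by rewrite -natrM ler1n muln_gt0.
have kM k := small_scale_le K N theta k K0 N0 hK th0.
elim=> [|n IH] k t s st hu hn.
  by have := kM _ hu; lia.
have u0 : 0 <= 3 ^+ k * theta by rewrite mulr_ge0 // exprn_ge0.
have hE := eval_Entry _ x _ _ _ _ _ _ _ 0 e0 e1 st.
have hq := hdet k hu.
set q := result m x _ in hE hq.
have s3 : s 3%N = k%:R by case: st => _ [].
have hpass : pass x counting_prog s =
    if q <= 1 / 50 then inr (fun i => if i == 3%N then k.+1%:R else s i)
    else inr (fun i => if i == 2%N then 1 else if i == 4%N then 1 else
                if i == 5%N then asin (Num.sqrt q) / 3 ^+ k else s i).
  have -> : pass x counting_prog s =
    if s 2%N <= 0 then
      if Defs.eval x s (Res (Entry 0)) <= 1 / 50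
      then inr (fun i => if i == 3%N then s 3%N + 1 else s i)
      else inr (fun i => if i == 2%N then 1 else if i == 4%N then 1 else
                if i == 5%N then asin (Num.sqrt (Defs.eval x s (Res (Entry 0)))) /
                  Defs.eval x s (Pow3 (Reg R 3)) else s i)
    else pass x (Test (Reg R 4) (Sub (Clog3 Domain) (Bin Omul (Cst 2) (Reg R 3)))
      (Test (Reg R 4) Accuracy
        (Test (Cst (1 / 16)) (Sqr (Slope 0)) (newton_prog 0) (newton_prog 1))
        return_prog)
      return_prog) s by [].
  by rewrite hE (eval_Pow3 _ x s _ k) // s3 natr1 natrX; case: st => [[_ _ ->] _]; rewrite lexx.
rewrite runS hpass.
have [hq1 hq2] : q - sin (3 ^+ k * theta) ^+ 2 <= 1 / 50 / 100 /\
    sin (3 ^+ k * theta) ^+ 2 - q <= 1 / 50 / 100.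
  by move: hq; rewrite ler_norml => /andP[]; lra.
case: leP => hthr.
  apply: (IH k.+1 t); last by rewrite subnS -subn1 leq_subLR add1n.
    case: st => [[a0 a1 a2] [a3 a4 a5]].
    by split; split.
  rewrite exprS -mulrA; set u := 3 ^+ k * theta in hu u0 hq1 hq2 *.
  (* Beyond [1 / 6], [sin u] is at least [7 / 48], whose square exceeds the threshold [1 / 50] plus
     the sampling error. *)
  suff : u <= 1 / 6 by lra.
  rewrite leNgt; apply/negP => h6.
  have hs : 7 / 48 <= sin u.
    apply: le_trans (sin_ge u u0).
    have -> : u - u ^+ 3 / 2 = u * (1 - u ^+ 2 / 2) by field.
    have : 7 / 8 <= 1 - u ^+ 2 / 2 by nra.
    move=> h7; have : 1 / 6 * (7 / 8) <= u * (1 - u ^+ 2 / 2) by apply: ler_pM; lra.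
    lra.
  have : (7 / 48) ^+ 2 <= sin u ^+ 2 by apply: lerXn2r; rewrite ?nnegrE; lra.
  lra.
have p0 : 0 < 3 ^+ k :> R by rewrite exprn_gt0.
set t0 := asin _ / _.
have ht0 : 3 ^+ (k + 0) * `|theta - t0| <= 1 / 500.
  rewrite addn0 -[X in X * _](gtr0_norm p0) -normrM.
  have -> : 3 ^+ k * (theta - t0) = 3 ^+ k * theta - asin (Num.sqrt q).
    by rewrite /t0; field; rewrite gt_eqF.
  by apply: asin_sqrt_close => //; exact: ltW.
have hsin : 1 / 50 - 1 / 50 / 100 <= sin (3 ^+ k * theta) ^+ 2 by lra.
(* The square of [7 / 50] is just below [1 / 50 - 1 / 50 / 100]. *)
have hu' : 7 / 50 <= 3 ^+ k * theta.
  rewrite leNgt; apply/negP => h; have := sqr_sin_le (3 ^+ k * theta).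
  set u := 3 ^+ k * theta in h u0 hsin *; nra.
have hn0 : (depth M E k - 0 < n)%N.
  have aux J M' E' : (J <= E')%N -> (2 * k <= M')%N -> (M' + E' + 3 - k <= n.+1)%N ->
    (J - 0 < n)%N by clear; lia.
  exact: aux (geq_minr _ _) (kM _ hu) hn.
pose s0 i := if i == 2%N then 1 else if i == 4%N then 1 else
  if i == 5%N then t0 else s i.
have hs0 : state N eps 1 k 1 t0 s0.
  by case: st => [[a0 a1 a2] [a3 a4 a5]]; split; split.
have [t' -> ht'] := run_refine m x N eps theta k N0 e0 e1 (kM _ hu) hsin u0 hu
  (fun j b => href k j b hu' hu) n 0 t0 s0 hs0 (leq0n _) ht0 hn0.
exists (Num.floor (8 * N%:R * sin t' ^+ 2 + 1 / 2))%:~R => //.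
apply: (count_from_angle K (8 * N%:R) (3 ^+ k) (3 ^+ depth M E k) theta) => //.
- exact: lt_le_trans D1.
- by rewrite exprn_ege1 // ler1n.
- by rewrite exprn_ege1 // ler1n.
- by rewrite -exprD.
(* If the count limits the depth, [A ^ 2 * L] is [9 ^ k * 3 ^ (M - 2 * k) = 3 ^ M]; otherwise [L] is
   [3 ^ E]. *)
- rewrite /depth; case: leqP => _; [left|right].
    rewrite -exprM -exprD mulnC subnKC; last exact: kM.
    exact: le_clog3.
  by apply: le_clog3; rewrite invf_ge1.
Qed.

(** * The schedule and its cost *)

Lemma big_ord_mul {R : Type} {idx : R} {op : Monoid.law idx} (n k : nat) (F : nat -> R) :
  \big[op/idx]_(i < n * k) F i =
  \big[op/idx]_(i < n) \big[op/idx]_(j < k) F (i * k + j)%N.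
Proof.
rewrite -(big_mkord xpredT F) big_nat_mul big_mkord; apply: eq_bigr => i _.
rewrite -{1}[(i * k)%N]add0n big_addn mulSn addnK big_mkord.
by apply: eq_bigr => j _; rewrite addnC.
Qed.

Definition scale_of (E n : nat) : nat := n %/ 2 %/ E.+1.
Definition stage_of (E n : nat) : nat := (n %/ 2) %% E.+1.
Definition variant_of (n : nat) : nat := n %% 2.

Lemma scale_entry (E k j s : nat) : (j <= E)%N -> (s < 2)%N ->
  scale_of E (entry E k j s) = k.
Proof.
move=> jE s2; rewrite /scale_of /entry divnMDl // (divn_small s2) addn0.
by rewrite divnMDl // divn_small // addn0.
Qed.

Lemma stage_entry (E k j s : nat) : (j <= E)%N -> (s < 2)%N ->
  stage_of E (entry E k j s) = j.
Proof.
move=> jE s2; rewrite /stage_of /entry divnMDl // (divn_small s2) addn0.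
by rewrite modnMDl modn_small.
Qed.

Lemma variant_entry (E k j s : nat) : (s < 2)%N -> variant_of (entry E k j s) = s.
Proof. by move=> s2; rewrite /variant_of /entry modnMDl modn_small. Qed.

Lemma entry_lt (E K k j s : nat) : (k < K)%N -> (j <= E)%N -> (s < 2)%N ->
  (entry E k j s < K * E.+1 * 2)%N.
Proof.
move=> kK jE s2; rewrite /entry.
have h1 : (k.+1 * E.+1 <= K * E.+1)%N by rewrite leq_mul2r kK orbT.
have h2 : (k * E.+1 + j < K * E.+1)%N.
  by apply: leq_trans h1; rewrite mulSn addnC ltn_add2r ltnS.
by move: h2 s2; move: (k * E.+1 + j)%N (K * E.+1)%N => a b; lia.
Qed.

Lemma big_entries {R : Type} {idx : R} {op : Monoid.law idx} (E K : nat) (F : nat -> R) :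
  \big[op/idx]_(n < K * E.+1 * 2) F n =
  \big[op/idx]_(k < K) \big[op/idx]_(j < E.+1) \big[op/idx]_(s < 2) F (entry E k j s).
Proof.
rewrite (big_ord_mul _ 2 F).
by rewrite (big_ord_mul K E.+1 (fun i => \big[op/idx]_(s < 2) F (i * 2 + s)%N)).
Qed.

(* Stages beyond the depth are never read; frequency [1] makes them cheap. *)
Definition entry_freq (M E n : nat) : nat :=
  if (stage_of E n <= depth M E (scale_of E n))%N
  then frequency (scale_of E n) (stage_of E n) (variant_of n) else 1.

(** [B] sets the confidence. The subtraction truncates, so an entry beyond the depth gets [B.+1]
    flips. *)
Definition entry_flips (B M E n : nat) : nat :=
  B.+1 * 2 ^ (depth M E (scale_of E n) - stage_of E n).

Lemma entry_freq_gt0 (M E n : nat) : (0 < entry_freq M E n)%N.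
Proof. by rewrite /entry_freq; case: ifP => // _; rewrite addn_gt0 expn_gt0. Qed.

(** Oddness makes [odd_floor] return the frequency itself. *)
Lemma odd_entry_freq (M E n : nat) : odd (entry_freq M E n).
Proof.
rewrite /entry_freq; case: ifP => // _.
by rewrite /frequency oddD oddX orbT -mulnA oddM.
Qed.

Definition table_size (M E : nat) : nat := (M./2).+1 * E.+1 * 2.

Lemma entry_freq_ge1 {R : realType} (M E n : nat) : 1 <= (entry_freq M E n)%:R :> R.
Proof. by rewrite ler1n entry_freq_gt0. Qed.

Lemma entry_flips_gt0 (B M E n : nat) : (0 < entry_flips B M E n)%N.
Proof. by rewrite muln_gt0 expn_gt0. Qed.

Definition table_schedule (R : realType) (B M E : nat) : grover_schedule R :=
  @GroverSchedule R (table_size M E)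
    (fun i => (entry_freq M E i)%:R) (fun i => entry_flips B M E i)
    (fun i => entry_freq_ge1 M E i) (fun i => entry_flips_gt0 B M E i).

(** * Summation of the query cost *)

Lemma sum_expn32 (J : nat) :
  (\sum_(j < J.+1) 3 ^ j * 2 ^ (J - j) + 2 ^ J.+1 = 3 ^ J.+1)%N.
Proof.
elim: J => [|J IH]; first by rewrite big_ord1.
rewrite big_ord_recr /= subnn muln1.
have -> : (\sum_(j < J.+1) 3 ^ j * 2 ^ (J.+1 - j) = 2 * \sum_(j < J.+1) 3 ^ j * 2 ^ (J - j))%N.
  rewrite big_distrr /=; apply: eq_bigr => j _.
  by rewrite subSn -1?ltnS // expnS mulnCA.
by move: IH; rewrite [(2 ^ J.+2)%N]expnS [(3 ^ J.+2)%N]expnS; lia.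
Qed.

Lemma frequency_le (k j s : nat) : (s < 2)%N -> (frequency k j s <= 3 * 3 ^ (k + j))%N.
Proof.
move=> s2; have h : (3 ^ k <= 3 ^ (k + j))%N by rewrite leq_exp2l // leq_addr.
rewrite /frequency; move: h; move: (3 ^ k)%N (3 ^ (k + j))%N => a b h.
by case: s s2 => [|[|//]] _; lia.
Qed.

(** The term [E.+1] pays for the entries beyond the depth. Of the factor 9, one 3 comes from
    [frequency_le] and the other from [sum_expn32], by which the last stage dominates in spite of
    the extra flips of the earlier ones. *)
Lemma scale_cost_le (B M E k : nat) :
  (\sum_(j < E.+1) \sum_(s < 2)
     entry_freq M E (entry E k j s) * entry_flips B M E (entry E k j s) <=
   2 * B.+1 * (E.+1 + 9 * 3 ^ (k + depth M E k)))%N.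
Proof.
set J := depth M E k.
have JE : (J <= E)%N by rewrite geq_minr.
have h (j : 'I_E.+1) : (\sum_(s < 2)
     entry_freq M E (entry E k j s) * entry_flips B M E (entry E k j s) <=
     2 * B.+1 + (if j < J.+1 then 2 * B.+1 * (3 * (3 ^ k * (3 ^ j * 2 ^ (J - j)))) else 0))%N.
  have hs (s : 'I_2) : (entry_freq M E (entry E k j s) * entry_flips B M E (entry E k j s) <=
     B.+1 + (if j < J.+1 then B.+1 * (3 * (3 ^ k * (3 ^ j * 2 ^ (J - j)))) else 0))%N.
    have jE : (j <= E)%N by rewrite -ltnS.
    rewrite /entry_freq /entry_flips scale_entry ?stage_entry ?variant_entry //.
    rewrite -/J ltnS; case: (leqP j J) => [jJ|Jj].
      apply: (leq_trans _ (leq_addl _ _)).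
      rewrite mulnCA leq_pmul2l //.
      apply: (leq_trans (leq_mul (frequency_le k j s (ltn_ord s)) (leqnn _))).
      by rewrite expnD !mulnA.
    have -> : (J - j = 0)%N by apply/eqP; rewrite subn_eq0 ltnW.
    by rewrite muln1 mul1n leq_addr.
  apply: leq_trans; first by apply: leq_sum => s _; exact: hs.
  rewrite sum_nat_const card_ord mulnDr.
  by case: ifP => _; rewrite ?muln0 // !mulnA.
apply: leq_trans; first by apply: leq_sum => j _; exact: h.
rewrite big_split /= sum_nat_const card_ord -big_mkcond /=.
rewrite -(big_ord_widen E.+1 (fun j => 2 * B.+1 * (3 * (3 ^ k * (3 ^ j * 2 ^ (J - j)))))%N) //.
rewrite -!big_distrr /= mulnDr leq_add //; first by rewrite mulnC.
rewrite leq_pmul2l // expnD mulnCA [in leqRHS]mulnCA leq_pmul2l ?expn_gt0 //.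
by rewrite (_ : 9 = 3 * 3)%N // -mulnA leq_pmul2l // -expnS -sum_expn32 leq_addr.
Qed.

(* The increment dominates [min x (1 / x)] while [x / (1 + x)] stays bounded,
   so a sum of minima along [x, 3 x, 9 x, ...] telescopes. *)
Lemma min_le_increment {R : realType} (A B s T : R) : 0 < A -> 0 < s ->
  A * B = s ^+ 2 -> T <= A -> T <= B ->
  T <= 4 * s * (3 * A / (s + 3 * A) - A / (s + A)).
Proof.
move=> A0 s0 hAB TA TB.
have d0 : 0 < (s + 3 * A) * (s + A) by rewrite mulr_gt0 //; lra.
have -> : 4 * s * (3 * A / (s + 3 * A) - A / (s + A)) =
    8 * A * s ^+ 2 / ((s + 3 * A) * (s + A)).
  by field; rewrite !gt_eqF //; lra.
rewrite ler_pdivlMr //.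
have [h|/ltW h] := leP A s.
  apply: (@le_trans _ _ (A * ((s + 3 * A) * (s + A)))).
    by apply: ler_wpM2r => //; exact: ltW.
  have -> : 8 * A * s ^+ 2 = A * (8 * s ^+ 2) by ring.
  apply: ler_wpM2l; first exact: ltW.
  have : 0 <= (s - A) * (4 * s + 3 * A + 3 * s) by apply: mulr_ge0; lra.
  nra.
apply: (@le_trans _ _ (B * ((s + 3 * A) * (s + A)))).
  by apply: ler_wpM2r => //; exact: ltW.
rewrite -hAB.
have B0 : 0 <= B.
  have : 0 <= A * B by rewrite hAB exprn_ge0 // ltW.
  by rewrite pmulr_rge0.
have -> : 8 * A * (A * B) = B * (8 * A ^+ 2) by ring.
apply: ler_wpM2l => //; nra.
Qed.

(** The two limits on the depth bound the term by [3 ^ (k + E)] and [3 ^ (M - k)], whose product is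
    [s ^ 2] at every scale; [min_le_increment] applies and the sum telescopes, with [h] between 0
    and 1. *)
Lemma sum_depth_le {R : realType} (M E K : nat) : (K <= (M./2).+1)%N ->
  \sum_(k < K) 3 ^+ (k + depth M E k) <= 4 * Num.sqrt (3 ^+ (M + E)) :> R.
Proof.
move=> KM; set s := Num.sqrt _.
have s0 : 0 < s by rewrite sqrtr_gt0 exprn_gt0.
pose h (k : nat) : R := 3 ^+ (k + E) / (s + 3 ^+ (k + E)).
have hstep (k : 'I_K) : true -> 3 ^+ (k + depth M E k) <= 4 * s * (h k.+1 - h k) :> R.
  have kM : (2 * k <= M)%N.
    have : (k <= M./2)%N by rewrite -ltnS (leq_trans (ltn_ord k)).
    by move/(leq_mul (leqnn 2)) => /leq_trans; apply; rewrite mul2n; lia.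
  move=> _; rewrite /h addSn exprS.
  apply: (min_le_increment _ (3 ^+ (M - k))) => //.
  - rewrite /s sqr_sqrtr ?exprn_ge0 // -exprD; congr (_ ^+ _); lia.
  - by rewrite ler_weXn2l ?ler1n // leq_add2l geq_minr.
  - rewrite ler_weXn2l ?ler1n //.
    have : (depth M E k <= M - 2 * k)%N by rewrite geq_minl.
    lia.
apply: (le_trans (ler_sum _ hstep)).
rewrite -mulr_sumr -(big_mkord xpredT (fun k => h k.+1 - h k)) telescope_sumr //.
have hK : h K <= 1.
  rewrite /h ler_pdivrMr ?mul1r ?lerDr ?ltW //.
  by rewrite addr_gt0 // exprn_gt0.
have h0 : 0 <= h 0%N.
  by rewrite /h divr_ge0 ?exprn_ge0 // addr_ge0 ?exprn_ge0 // ltW.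
rewrite -[leRHS]mulr1; apply: ler_wpM2l; first by rewrite mulr_ge0 // ltW.
lra.
Qed.

Lemma sqrS_le_expn3 (n : nat) : (n.+1 ^ 2 <= 4 * 3 ^ n)%N.
Proof.
elim: n => [//|[//|n] IH].
by move: IH; rewrite [(3 ^ n.+2)%N]expnS !expnS !expn0 !muln1; nia.
Qed.

Lemma table_cost_le (R : realType) (B M E : nat) :
  query_cost (table_schedule R B M E) <= 40 * B.+1%:R * Num.sqrt (3 ^+ (M + E)).
Proof.
set s := Num.sqrt _.
rewrite /query_cost /=.
under eq_bigr => i _ do rewrite -natrM.
rewrite -natr_sum.
rewrite (big_entries E _ (fun n => entry_freq M E n * entry_flips B M E n)%N).
have h : (\sum_(k < (M./2).+1) \sum_(j < E.+1) \sum_(i < 2)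
    entry_freq M E (entry E k j i) * entry_flips B M E (entry E k j i) <=
    \sum_(k < (M./2).+1) 2 * B.+1 * (E.+1 + 9 * 3 ^ (k + depth M E k)))%N.
  by apply: leq_sum => k _; exact: scale_cost_le.
(* The number of cells is only logarithmic in the parameters, so [sqrS_le_expn3] absorbs it into
   [s]. *)
have hpad : ((M./2).+1 * E.+1)%:R <= 4 * s.
  have h16 : 4 * s = Num.sqrt (16 * 3 ^+ (M + E)).
    have -> : 16 = 4 ^+ 2 :> R by rewrite -natrX.
    by rewrite sqrtrM ?sqr_ge0 // sqrtr_sqr ger0_norm.
  rewrite h16 -[leLHS]ger0_norm // -sqrtr_sqr ler_sqrt ?mulr_ge0 ?exprn_ge0 //.
  rewrite -natrX -natrX -natrM ler_nat expnMn expnD.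
  have h1 : ((M./2).+1 ^ 2 <= 4 * 3 ^ M)%N.
    by apply: leq_trans (sqrS_le_expn3 M); rewrite leq_exp2r // ltnS; lia.
  have := leq_mul h1 (sqrS_le_expn3 E).
  by move/leq_trans; apply; rewrite mulnACA.
apply: (@le_trans _ _ (2^-1 * (2 * B.+1 * ((M./2).+1 * E.+1 +
    9 * \sum_(k < (M./2).+1) 3 ^ (k + depth M E k)))%:R)).
  apply: ler_wpM2l => //; rewrite ler_nat; apply: (leq_trans h).
  by rewrite -big_distrr /= big_split /= sum_nat_const card_ord -big_distrr.
rewrite natrM natrM natrD [(9 * _)%:R]natrM natr_sum.
under eq_bigr => k _ do rewrite natrX.
have hsum := sum_depth_le (R := R) M E _ (leqnn _).
rewrite -/s in hsum.
have -> (z : R) : 2^-1 * (2 * B.+1%:R * z) = B.+1%:R * z by field.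
(* Here 40 is 4 from [hpad] plus 9 times 4 from [sum_depth_le]. *)
have -> : 40 * B.+1%:R * s = B.+1%:R * (40 * s) by ring.
apply: ler_wpM2l => //; lra.
Qed.

Lemma clog3_le_ln {R : realType} (x : R) : 1 <= x -> (clog3 x)%:R <= ln x / ln 3 + 1.
Proof.
move=> x1; rewrite /clog3 -natr1 lerD2r truncn_le divr_ge0 ?ln_ge0 //.
by rewrite ler1n.
Qed.

(** * The failure probability *)

Lemma odd_floor_nat {R : realType} (n : nat) : odd n -> odd_floor (n%:R : R) = n.
Proof.
move=> on; rewrite /odd_floor natrK; apply/eqP; rewrite eqn_leq; apply/andP; split.
  by apply/bigmax_leqP => i _; rewrite -ltnS.
exact: (leq_bigmax_cond (ord_max : 'I_n.+1)).
Qed.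

(** Vectors of counts form a countable set, so the event is a countable union of cylinders, whatever
    [Q] is. *)
Lemma measurable_finite_event (d : measure_display) (T : measurableType d) (m : nat)
    (X : 'I_m -> {mfun T >-> nat}) (Q : ('I_m -> nat) -> Prop) :
  measurable [set w | Q (fun i => X i w)].
Proof.
pose F (v : {ffun 'I_m -> nat}) : set T :=
  if `[< Q v >] then \bigcap_(i in [set: 'I_m]) (X i @^-1` [set v i]) else set0.
have -> : [set w | Q (fun i => X i w)] = \bigcup_v F v.
  apply/seteqP; split=> [w /= Qw|w [v _]]; rewrite /F.
    exists [ffun i => X i w] => //=; rewrite /F.
    have -> : ([ffun i => X i w] : 'I_m -> nat) = (fun i => X i w).
      by apply/funext => i; rewrite ffunE.
    by rewrite asboolT.
  case: asboolP => // Qv Fw /=.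
  by have -> : (fun i => X i w) = v by apply/funext => i; exact: Fw.
apply: countable_bigcupT_measurable => [|v]; first exact: countableP.
rewrite /F; case: ifP => _; last exact: measurable0.
apply: fin_bigcap_measurable => [|i _]; first exact: finite_finset.
exact: measurable_funPTI.
Qed.

(* The entries whose deviation could mislead the post-processing: the first
   column up to the scale of the angle, and the rows at that scale. *)
Definition relevant {R : realType} (M E : nat) (theta : R) (n : nat) : bool :=
  let u := 3 ^+ scale_of E n * theta in
  [&& u <= 1 / 2, (stage_of E n <= depth M E (scale_of E n))%N &
      ((stage_of E n == 0) && (variant_of n == 0)) || (7 / 50 <= u)].

(* [p * (1 - p) <= 13 * u_k ^ 2] for relevant entries: [p <= u_k ^ 2] in the first
   column, and [1 / 4 <= 13 * (7 / 50) ^ 2] elsewhere. *)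
Definition variance_ratio {R : realType} : R := 13 / (1 / 50 / 100) ^+ 2.

(** The factor [(3 ^ k * theta) ^ 2] reflects the small variance of coins of small phase; it lets
    the union bound over all scanned scales converge. *)
Lemma deviation_prob {R : realType} (B M E : nat) (theta : R)
    (d : measure_display) (T : measurableType d) (P : probability T R)
    (X : 'I_(table_size M E) -> {RV P >-> nat}) (i : 'I_(table_size M E)) :
  performs (S := table_schedule R B M E) theta X -> relevant M E theta i ->
  (P [set w | (1 / 50 / 100 <
      `|phat (S := table_schedule R B M E) X w i
        - sin ((entry_freq M E i)%:R * theta) ^+ 2|)%R] <=
   (variance_ratio * (3 ^+ scale_of E i * theta) ^+ 2 / (entry_flips B M E i)%:R)%:E)%E.
Proof.
move=> [_ hX] /and3P[hu hj hrel].
set p := sin _ ^+ 2.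
have p0 : 0 <= p by rewrite sqr_ge0.
have p1 : p <= 1 by rewrite /p sin2cos2 gerBl sqr_ge0.
have eta0 : 0 < 1 / 50 / 100 :> R by lra.
have t0 : (0 < entry_flips B M E i)%N by exact: entry_flips_gt0.
have := hX i [set k | (1 / 50 / 100 < `|k%:R / (entry_flips B M E i)%:R - p|)%R].
rewrite /grover_bias /= odd_floor_nat ?odd_entry_freq // -/p.
rewrite /distribution /pushforward => hdist.
have -> : [set w | (1 / 50 / 100 <
      `|phat (S := table_schedule R B M E) X w i - p|)%R] =
  X i @^-1` [set k | (1 / 50 / 100 < `|k%:R / (entry_flips B M E i)%:R - p|)%R] by [].
rewrite hdist; apply: (le_trans (binomial_chebyshev _ _ _ p0 p1 t0 eta0)).
rewrite lee_fin.
set u := 3 ^+ _ * theta in hu hrel *.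
have tR : 0 < (entry_flips B M E i)%:R :> R by rewrite ltr0n.
have hp : p * (1 - p) <= 13 * u ^+ 2.
  case/orP: hrel => [/andP[/eqP j0 /eqP s0]|hu'].
    have -> : p = sin u ^+ 2.
      by rewrite /p /entry_freq hj /frequency j0 s0 /= !addn0 natrX.
    have := sqr_sin_le u.
    have := sqr_ge0 (sin u); have := sqr_ge0 u; nra.
  have : (7 / 50) ^+ 2 <= u ^+ 2 by apply: lerXn2r; rewrite ?nnegrE; lra.
  have : p * (1 - p) <= 1 / 4 by have := sqr_ge0 (p - 1 / 2); nra.
  lra.
rewrite /variance_ratio.
set e := (1 / 50 / 100) ^+ 2; set t := _%:R in tR *.
have e0 : 0 < e by rewrite exprn_gt0.
have -> : 13 / e * u ^+ 2 / t = 13 * u ^+ 2 / (t * e) by field; rewrite !gt_eqF.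
by apply: ler_wpM2r => //; rewrite invr_ge0 mulr_ge0 // ltW.
Qed.

(** * Union bound over the table *)

Lemma sum_geometric_sqr {R : realType} (theta : R) (K : nat) :
  \sum_(k < K.+1) (3 ^+ k * theta) ^+ 2 <= 9 / 8 * (3 ^+ K * theta) ^+ 2.
Proof.
elim: K => [|K IH].
  by rewrite big_ord1 /=; have := sqr_ge0 (3 ^+ 0 * theta); lra.
rewrite big_ord_recr /= [3 ^+ K.+1]exprS -mulrA exprMn.
move: IH; set u := 3 ^+ K * theta; lra.
Qed.

(** The last scale with phase at most [1 / 2] dominates the geometric sum:
    [9 / 8 * (1 / 2) ^ 2 = 9 / 32]. *)
Lemma sum_small_scales {R : realType} (theta : R) (K : nat) : 0 <= theta ->
  \sum_(k < K | 3 ^+ k * theta <= 1 / 2) (3 ^+ k * theta) ^+ 2 <= 9 / 32.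
Proof.
move=> th0; elim: K => [|K IH]; first by rewrite big_ord0 divr_ge0.
rewrite big_mkcond big_ord_recr /= -big_mkcond /=; case: ifP => h.
  have h1 : \sum_(k < K | 3 ^+ k * theta <= 1 / 2) (3 ^+ k * theta) ^+ 2 <=
      \sum_(k < K) (3 ^+ k * theta) ^+ 2.
    rewrite [leRHS](bigID (fun k : 'I_K => 3 ^+ k * theta <= 1 / 2)) /= lerDl.
    by apply: sumr_ge0 => k _; exact: sqr_ge0.
  have := sum_geometric_sqr theta K; rewrite big_ord_recr /= => h2.
  have h3 : 0 <= 3 ^+ K * theta by rewrite mulr_ge0 // exprn_ge0.
  have h4 : (3 ^+ K * theta) ^+ 2 <= 1 / 4 by nra.
  lra.
by rewrite addr0.
Qed.

Lemma sum_inv_expn2 {R : realType} (J : nat) :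
  \sum_(j < J.+1) (2 ^+ (J - j))^-1 <= 2 :> R.
Proof.
elim: J => [|J IH]; first by rewrite big_ord1 invr1; lra.
rewrite big_ord_recr /= subnn expr0 invr1.
have -> : \sum_(j < J.+1) (2 ^+ (J.+1 - j))^-1 =
    2^-1 * \sum_(j < J.+1) (2 ^+ (J - j))^-1 :> R.
  rewrite mulr_sumr; apply: eq_bigr => j _.
  by rewrite subSn -1?ltnS // exprS invfM.
lra.
Qed.

(** Two variants and a geometric sum over the stages, each a factor 2, leave
    [4 * c * (3 ^ k * theta) ^ 2] per scale; the sum over the scales multiplies this by at most
    [9 / 32]. *)
Lemma sum_deviation_bounds {R : realType} (B M E : nat) (theta : R) : 0 <= theta ->
  \sum_(n < table_size M E | relevant M E theta n)
     variance_ratio * (3 ^+ scale_of E n * theta) ^+ 2 / (entry_flips B M E n)%:R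
  <= 2 * variance_ratio / B.+1%:R.
Proof.
move=> th0.
have v0 : 0 < variance_ratio :> R by rewrite divr_gt0 // exprn_gt0 // !divr_gt0.
have B0 : 0 < B.+1%:R :> R by rewrite ltr0n.
pose c : R := variance_ratio / B.+1%:R.
have c0 : 0 < c by rewrite divr_gt0.
pose G (n : nat) : R := if relevant M E theta n then
   variance_ratio * (3 ^+ scale_of E n * theta) ^+ 2 / (entry_flips B M E n)%:R else 0.
rewrite big_mkcond /= (big_entries E _ G).
apply: (@le_trans _ _ (\sum_(k < (M./2).+1 | 3 ^+ k * theta <= 1 / 2)
    4 * c * (3 ^+ k * theta) ^+ 2)); last first.
  rewrite -mulr_sumr; have := sum_small_scales theta (M./2).+1 th0 => h.
  apply: (le_trans (ler_wpM2l _ h)); first by rewrite mulr_ge0 // ltW.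
  have -> : 2 * variance_ratio / B.+1%:R = 2 * c by rewrite /c mulrA.
  lra.
rewrite [leRHS]big_mkcond /=; apply: ler_sum => k _.
set J := depth M E k.
have JE : (J <= E)%N by rewrite geq_minr.
case: ifP => hu; last first.
  apply: sumr_le0 => j _; apply: sumr_le0 => s _.
  have jE : (j <= E)%N by rewrite -ltnS.
  by rewrite /G /relevant scale_entry // hu.
apply: (@le_trans _ _ (\sum_(j < E.+1 | (j < J.+1)%N)
     2 * (c * (3 ^+ k * theta) ^+ 2) * (2 ^+ (J - j))^-1)).
  rewrite [leRHS]big_mkcond /=; apply: ler_sum => j _.
  have jE : (j <= E)%N by rewrite -ltnS.
  have hG (s : 'I_2) : G (entry E k j s) <= if (j < J.+1)%N then
      c * (3 ^+ k * theta) ^+ 2 * (2 ^+ (J - j))^-1 else 0.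
    rewrite /G /relevant /entry_flips scale_entry // stage_entry // hu ltnS -/J /=.
    case: (leqP j J) => [jJ|//] /=.
    rewrite natrM natrX.
    set g := c * _ * _.
    have g0 : 0 <= g.
      by rewrite !mulr_ge0 ?sqr_ge0 ?invr_ge0 ?exprn_ge0 // ltW.
    case: ifP => _ //.
    by rewrite /g /c invfM le_eqVlt; apply/orP; left; apply/eqP; ring.
  apply: (le_trans (ler_sum _ (fun s _ => hG s))).
  rewrite sumr_const card_ord; case: ifP => _; rewrite ?mul0rn // -mulr_natl; lra.
rewrite -(big_ord_widen E.+1 (fun j => 2 * (c * (3 ^+ k * theta) ^+ 2) * (2 ^+ (J - j))^-1)) //.
rewrite -mulr_sumr.
have h := @sum_inv_expn2 R J.
have hc : 0 <= 2 * (c * (3 ^+ k * theta) ^+ 2).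
  by rewrite !mulr_ge0 ?sqr_ge0 // ltW.
have := ler_wpM2l hc h; lra.
Qed.

Lemma prob_all_close {R : realType} (B M E : nat) (theta : R)
    (d : measure_display) (T : measurableType d) (P : probability T R)
    (X : 'I_(table_size M E) -> {RV P >-> nat}) (V : set T) :
  0 <= theta -> performs (S := table_schedule R B M E) theta X -> measurable V ->
  (forall w, (forall n, (n < table_size M E)%N -> relevant M E theta n ->
     `|result _ (phat (S := table_schedule R B M E) X w) n
       - sin ((entry_freq M E n)%:R * theta) ^+ 2| <= 1 / 50 / 100) -> V w) ->
  ((1 - 2 * variance_ratio / B.+1%:R)%:E <= P V)%E.
Proof.
move=> th0 hX mV hV.
pose x := phat (S := table_schedule R B M E) X.
(* Making [bad n] empty at irrelevant entries allows Boole's inequality over the whole table. *)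
pose bad (n : nat) : set T := [set w | relevant M E theta n &&
  (1 / 50 / 100 < `|result _ (x w) n - sin ((entry_freq M E n)%:R * theta) ^+ 2|)].
have badE (i : 'I_(table_size M E)) : bad i = if relevant M E theta i then
    [set w | (1 / 50 / 100 <
      `|x w i - sin ((entry_freq M E i)%:R * theta) ^+ 2|)%R] else set0.
  rewrite /bad; case: ifP => _; apply/seteqP; split => w //=.
  - by rewrite result_ord.
  - by rewrite result_ord.
have mbad n : (n < table_size M E)%N -> measurable (bad n).
  move=> hn; have := badE (Ordinal hn) => /= ->; case: ifP => // _.
  rewrite (_ : [set _ | _] = X (Ordinal hn) @^-1` [set k | (1 / 50 / 100 <
    `|k%:R / (entry_flips B M E n)%:R - sin ((entry_freq M E n)%:R * theta) ^+ 2|)%R]) //.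
  exact: measurable_funPTI.
pose U := \big[setU/set0]_(n < table_size M E) bad n.
have mU : measurable U.
  by apply: bigsetU_measurable => i _; apply: mbad.
have PU : (P U <= (2 * variance_ratio / B.+1%:R)%:E)%E.
  apply: (le_trans (Boole_inequality P mbad)).
  apply: (@le_trans _ _ (\sum_(n < table_size M E | relevant M E theta n)
     variance_ratio * (3 ^+ scale_of E n * theta) ^+ 2 / (entry_flips B M E n)%:R)%:E); last first.
    by rewrite lee_fin; exact: sum_deviation_bounds.
  rewrite -sumEFin [leRHS]big_mkcond /=; apply: lee_sum => i _.
  rewrite badE; case: ifP => hrel; last by rewrite measure0.
  exact: deviation_prob.
apply: (@le_trans _ _ (P (~` U))).
  by rewrite probability_setC // EFinB; apply: leeB.
apply: le_measure; rewrite ?inE //; first exact: measurableC.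
move=> w Uw; apply: hV => n hn hrel.
rewrite leNgt; apply/negP => h; apply: Uw.
rewrite /U -(bigcup_mkord _ bad); exists n => //=.
by rewrite /bad /= hrel.
Qed.

Lemma marked_pad (c N : nat) (f : 'I_N -> bool) : (0 < c)%N ->
  marked (pad (c := c) f) = marked f.
Proof.
move=> c0; rewrite /marked.
have le : (N <= c * N)%N by rewrite leq_pmull.
have inj : injective (widen_ord le) by move=> a b /(congr1 val) /= /val_inj.
rewrite -(fintype.card_image inj).
apply: eq_card => y; rewrite !inE /pad.
apply/idP/fintype.imageP => [|[x fx ->]].
  case: insubP => // x xN xy fx; exists x => //.
  by apply: val_inj; rewrite /= xy.
by rewrite /= valK.
Qed.

(** * Approximate counting *)

Lemma asin_le_half {R : realType} (x : R) : 0 <= x -> x <= 1 / 4 ->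
  0 <= asin x <= 1 / 2.
Proof.
move=> x0 x1.
have xin : -1 <= x <= 1 by apply/andP; split; lra.
have pi2 : 1 <= pi / 2 :> R by have := pi_ge2 R; lra.
have sx : sin (asin x) = x by apply: asinK; rewrite in_itv.
have ax : asin x \in `[- (pi / 2), pi / 2] by rewrite in_itv /= asin_geNpi2 ?asin_lepi2.
apply/andP; split; rewrite leNgt; apply/negP.
  rewrite -ltr_sin ?in_itv //=; last by apply/andP; split; lra.
  by rewrite sx sin0 ltNge x0.
rewrite -ltr_sin //=; last by rewrite in_itv /=; apply/andP; split; lra.
rewrite sx; have h0 : 0 <= 1 / 2 :> R by lra.
have := sin_ge (1 / 2 : R) h0; lra.
Qed.

(** Padding by 8 brings the marked fraction to at most [1 / 16], so the scan may start at scale 0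
    with a phase of at most [1 / 2]. *)
Lemma pad_angle {R : realType} (N : nat) (f : 'I_N -> bool) :
  (0 < N)%N -> (marked f)%:R <= N%:R / 2 :> R ->
  let theta := grover_angle R (pad (c := 8) f) in
  8 * N%:R * sin theta ^+ 2 = (marked f)%:R /\ 0 <= theta <= 1 / 2.
Proof.
move=> N0 hf; rewrite /grover_angle marked_pad //.
have NR : 0 < N%:R :> R by rewrite ltr0n.
set q := _ / (8 * N)%:R.
have qE : 8 * N%:R * q = (marked f)%:R by rewrite /q natrM; field; rewrite gt_eqF.
have q0 : 0 <= q by rewrite divr_ge0.
have q1 : q <= 1 / 16.
  rewrite /q ler_pdivrMr ?ltr0n ?muln_gt0 // natrM; lra.
have w0 : 0 <= Num.sqrt q by rewrite sqrtr_ge0.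
have w2 : Num.sqrt q ^+ 2 = q by rewrite sqr_sqrtr.
have w1 : Num.sqrt q <= 1 / 4 by rewrite leNgt; apply/negP => h; nra.
split; last exact: asin_le_half.
by rewrite asinK ?w2 // in_itv /=; apply/andP; split; lra.
Qed.

Definition count_level {R : realType} (N : nat) : nat := clog3 (8 * N%:R : R).
Definition accuracy_level {R : realType} (eps : R) : nat := clog3 eps^-1.

(** By [clog3_le] the power of 3 is at most [72 * (N / eps)], and [72 <= 9 ^ 2]. *)
Lemma table_cost_sqrt {R : realType} (B N : nat) (eps : R) :
  (0 < N)%N -> 0 < eps -> eps <= 1 ->
  query_cost (table_schedule R B (count_level (R := R) N) (accuracy_level eps)) <=
  360 * B.+1%:R * Num.sqrt (N%:R / eps).
Proof.
move=> N0 e0 e1; apply: (le_trans (table_cost_le _ _ _ _)).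
have -> : 360 * B.+1%:R * Num.sqrt (N%:R / eps) =
    40 * B.+1%:R * (9 * Num.sqrt (N%:R / eps)) by ring.
apply: ler_wpM2l; first by rewrite mulr_ge0.
have -> : 9 * Num.sqrt (N%:R / eps) = Num.sqrt (81 * (N%:R / eps)).
  have -> : 81 = 9 ^+ 2 :> R by rewrite -natrX.
  by rewrite [RHS]sqrtrM ?sqr_ge0 // sqrtr_sqr ger0_norm.
have NR : 0 < N%:R / eps by rewrite divr_gt0 // ltr0n.
rewrite ler_sqrt; last by rewrite mulr_ge0 // ltW.
have D1 : 1 <= 8 * N%:R :> R by rewrite -natrM ler1n muln_gt0.
have i1 : 1 <= eps^-1 by rewrite invf_ge1.
rewrite exprD; apply: (le_trans (ler_pM _ _ (clog3_le _ D1) (clog3_le _ i1))).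
- by rewrite exprn_ge0.
- by rewrite exprn_ge0.
- have -> : 3 * (8 * N%:R) * (3 * eps^-1) = 72 * (N%:R / eps) by ring.
  by rewrite ler_pM2r // ler_nat.
Qed.

Lemma table_passes_le {R : realType} (N : nat) (eps : R) :
  (0 < N)%N -> N%:R^-1 <= eps -> eps <= 1 ->
  (count_level (R := R) N + accuracy_level eps + 3)%:R <=
  (5 + ln 8 / ln 3 + 2 / ln 3) * (1 + ln (N%:R : R)).
Proof.
move=> N0 hN e1.
have NR : 0 < N%:R :> R by rewrite ltr0n.
have e0 : 0 < eps by apply: lt_le_trans hN; rewrite invr_gt0.
have D1 : 1 <= 8 * N%:R :> R by rewrite -natrM ler1n muln_gt0.
have i1 : 1 <= eps^-1 by rewrite invf_ge1.
have h1 := clog3_le_ln _ D1; have h2 := clog3_le_ln _ i1.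
have l3 := ln3_gt0 (R := R).
have l8 : 0 <= ln 8 / ln 3 :> R by rewrite divr_ge0 ?ln_ge0 ?ler1n.
have lN : 0 <= ln (N%:R : R) by rewrite ln_ge0 // ler1n.
have hle : ln eps^-1 <= ln (N%:R : R).
  rewrite ler_ln ?posrE ?invr_gt0 //.
  by rewrite -[leRHS]invrK lef_pV2 ?posrE ?invr_gt0.
have i3 : 0 < (ln 3)^-1 :> R by rewrite invr_gt0.
have h3 : ln eps^-1 / ln 3 <= ln (N%:R : R) / ln 3 by apply: ler_wpM2r => //; exact: ltW.
have h4 : ln (8 * N%:R : R) / ln 3 = ln 8 / ln 3 + ln (N%:R : R) / ln 3.
  by rewrite lnM ?posrE // mulrDl.
rewrite h4 in h1.
rewrite !natrD; apply: (@le_trans _ _ (5 + ln 8 / ln 3 + 2 * (ln (N%:R : R) / ln 3))).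
  rewrite /count_level /accuracy_level; lra.
have m1 : 0 <= ln 8 / ln 3 * ln (N%:R : R) by rewrite mulr_ge0.
rewrite mulrDr mulr1 [leRHS]addrC.
have -> : (5 + ln 8 / ln 3 + 2 / ln 3) * ln (N%:R : R) =
  5 * ln (N%:R : R) + ln 8 / ln 3 * ln (N%:R : R) + 2 * (ln (N%:R : R) / ln 3) by ring.
have : 0 <= 2 / ln 3 :> R by rewrite divr_ge0 // ltW.
lra.
Qed.

Lemma post_process_correct {R : realType} (m : nat) (x : 'I_m -> R) (N K : nat) (eps theta : R)
    (M := count_level (R := R) N) (E := accuracy_level eps) :
  (0 < K)%N -> (0 < N)%N -> 0 < eps -> eps <= 1 ->
  8 * N%:R * sin theta ^+ 2 = K%:R -> 0 <= theta -> theta <= 1 / 2 ->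
  (forall n, (n < table_size M E)%N -> relevant M E theta n ->
     `|result _ x n - sin ((entry_freq M E n)%:R * theta) ^+ 2| <= 1 / 50 / 100) ->
  (1 + eps)^-1 <= post_process counting_prog (M + E + 3) N eps x / K%:R <= 1 + eps.
Proof.
move=> K0 N0 e0 e1 hK th0 th1 hx.
(* Every scale that the scan can reach is a row of the table. *)
have hrow k : 3 ^+ k * theta <= 1 / 2 -> (k < (M./2).+1)%N.
  move=> hu; have := small_scale_le K N theta k K0 N0 hK th0 hu.
  by move/half_leq; rewrite mul2n doubleK ltnS.
have hst : state N eps 0 0 0 0 (fun k => if k is 0%N then N%:R else
                               if k is 1%N then eps else 0) by [].
have hth : 3 ^+ 0 * theta <= 1 / 2 by rewrite expr0 mul1r.
have [k hu|k j b hu1 hu2 /andP[j0 jJ] b2||y] :=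
  run_counting_prog m x N K eps theta K0 N0 e0 e1 hK th0 _ _ (M + E + 3) 0 0 _ hst hth.
- have := hx (entry E k 0 0) (entry_lt _ _ _ 0 0 (hrow k hu) (leq0n _) isT).
  rewrite /relevant /entry_freq scale_entry // stage_entry // variant_entry // hu /=.
  rewrite /frequency !addn0 natrX; exact.
- have jE : (j <= E)%N by apply: leq_trans jJ (geq_minr _ _).
  have := hx (entry E k j b) (entry_lt _ _ _ _ _ (hrow k hu2) jE b2).
  rewrite /relevant /entry_freq scale_entry // stage_entry // variant_entry // hu2 hu1.
  by rewrite jJ orbT; exact.
- by rewrite subn0.
- by rewrite /post_process => ->.
Qed.

Theorem theorem2 (R : realType) (delta : R) (delta_gt0 : 0 < delta) :
  exists (c : nat) (C : R) (S : nat -> R -> grover_schedule R) (p : prog R)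
         (steps : nat -> R -> nat),
    (0 < c)%N /\
    forall (N : nat) (eps : R),
      (0 < N)%N -> N%:R^-1 <= eps -> eps <= 1 ->
      [/\ query_cost (S N eps) <= C * Num.sqrt (N%:R / eps),
          (steps N eps)%:R <= C * (1 + ln (N%:R : R)) &
          forall f : 'I_N -> bool,
            (1 <= marked f)%N -> (marked f)%:R <= N%:R / 2 :> R ->
          forall (d : measure_display) (T : measurableType d)
                 (P : probability T R)
                 (X : 'I_(gs_len (S N eps)) -> {RV P >-> nat}),
            performs (grover_angle R (pad (c := c) f)) X ->
            ((1 - delta)%R%:E <=
             P [set w | ((1 + eps)^-1 <=
                   post_process p (steps N eps) N eps (phat X w)
                     / (marked f)%:R <= 1 + eps)%R])%E].
Proof.
(* Then [B.+1] exceeds [2 * variance_ratio / delta], so the failure bound of [prob_all_close] is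
   below [delta]. *)
pose B := Num.truncn (2 * variance_ratio / delta).
pose C1 : R := 360 * B.+1%:R; pose C2 : R := 5 + ln 8 / ln 3 + 2 / ln 3.
have C10 : 0 <= C1 by rewrite mulr_ge0.
have C20 : 0 <= C2 by rewrite !addr_ge0 // divr_ge0 ?ln_ge0 ?ler1n.
exists 8%N, (C1 + C2),
  (fun N eps => table_schedule R B (count_level (R := R) N) (accuracy_level eps)),
  counting_prog, (fun N eps => count_level (R := R) N + accuracy_level eps + 3)%N.
split=> // N eps N0 hN e1.
have NR : 0 < N%:R :> R by rewrite ltr0n.
have e0 : 0 < eps by apply: lt_le_trans hN; rewrite invr_gt0.
split.
- apply: (le_trans (table_cost_sqrt B N eps N0 e0 e1)).
  by apply: ler_wpM2r; rewrite ?sqrtr_ge0 // lerDl.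
- apply: (le_trans (table_passes_le N eps N0 hN e1)).
  by apply: ler_wpM2r; rewrite ?addr_ge0 ?ln_ge0 ?ler1n // lerDr.
move=> f K0 hf d T P X hX.
have [hK /andP[th0 th1]] := pad_angle N f N0 hf.
set V := (X in P X).
have mV : measurable V.
  exact: (measurable_finite_event _ _ _ X (fun v => (1 + eps)^-1 <=
    post_process counting_prog (count_level (R := R) N + accuracy_level eps + 3) N eps
      (fun i => (v i)%:R / (gs_t (g := table_schedule R B (count_level (R := R) N) (accuracy_level eps)) i)%:R)
       / (marked f)%:R <= 1 + eps)).
apply: le_trans (prob_all_close B _ _ _ _ _ _ X V th0 hX mV _); last first.
  move=> w hw; exact: (post_process_correct _ _ _ _ _ _ K0 N0 e0 e1 hK th0 th1 hw).
rewrite lee_fin lerD2l lerN2 ler_pdivrMr ?ltr0n // -ler_pdivrMl // [_^-1 * _]mulrC.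
by rewrite ltW // truncnS_gt.
Qed.
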